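(* The radicals $(S_{\mathrm{Abel}}^{\mathbf{s}})^{\ast}$ and $P_{V}^{\circ}$ coincide, that is, $(S_{\mathrm{Abel}}^{\mathbf{s}})^{\ast}(\mathcal{L})=P_{V}^{\circ}(\mathcal{L})$ for every Banach Lie algebra $\mathcal{L}$.
   Context: A Banach Lie algebra is a complex Lie algebra $\mathcal{L}$ which is a Banach space in some norm such that, for some constant $t_{\mathcal{L}}>0$, $\|[a,b]\|\leq t_{\mathcal{L}}\|a\|\|b\|$ for all $a,b\in\mathcal{L}$. A Lie subalgebra $I$ of $\mathcal{L}$ is a Lie subideal if there are Lie subalgebras $I=J_{0}\subseteq J_{1}\subseteq\cdots\subseteq J_{n}=\mathcal{L}$ with each $J_{i}$ a Lie ideal of $J_{i+1}$. A closed Lie ideal $J$ of $\mathcal{L}$ is called primitive if, for any Lie subideal $A$ of $\mathcal{L}$, $[A,A]\subseteq J$ implies $A\subseteq J$. $P_{V}(\mathcal{L})$ is the intersection of all closed primitive Lie ideals of $\mathcal{L}$. A map $R$ that sends each Banach Lie algebra $\mathcal{L}$ to a closed Lie ideal $R(\mathcal{L})$ is a preradical if $f(R(\mathcal{L}))\subseteq R(\mathcal{M})$ for each bounded Lie homomorphism $f:\mathcal{L}\to\mathcal{M}$ with dense image; it is a radical if moreover, for all $\mathcal{L}$, $R(R(\mathcal{L}))=R(\mathcal{L})$, $R(\mathcal{L}/R(\mathcal{L}))=\{0\}$, and $R(I)\subseteq R(\mathcal{L})$ for each closed Lie ideal $I$ of $\mathcal{L}$. For a preradical $R$: put $R^{0}(\mathcal{L})=\mathcal{L}$,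 $R^{\alpha+1}(\mathcal{L})=R(R^{\alpha}(\mathcal{L}))$, $R^{\alpha}(\mathcal{L})=\bigcap_{\alpha'<\alpha}R^{\alpha'}(\mathcal{L})$ for limit ordinals $\alpha$; $R^{\circ}(\mathcal{L})$ is the stable value of this decreasing chain. Put $R^{(0)}(\mathcal{L})=\{0\}$, $R^{(\alpha+1)}(\mathcal{L})=q_{\alpha}^{-1}\big(R(\mathcal{L}/R^{(\alpha)}(\mathcal{L}))\big)$ with $q_{\alpha}:\mathcal{L}\to\mathcal{L}/R^{(\alpha)}(\mathcal{L})$ the quotient map, and $R^{(\alpha)}(\mathcal{L})=\overline{\bigcup_{\alpha'<\alpha}R^{(\alpha')}(\mathcal{L})}$ for limit ordinals $\alpha$; $R^{\ast}(\mathcal{L})$ is the stable value of this increasing chain. $R^{\mathbf{s}}(\mathcal{L})$ is the closed linear span of all closed Lie subideals $I$ of $\mathcal{L}$ with $R(I)=I$. $S_{\mathrm{Abel}}(\mathcal{L})$ is the closed linear span of all (closed) commutative Lie ideals of $\mathcal{L}$. The maps $S_{\mathrm{Abel}}$, $S_{\mathrm{Abel}}^{\mathbf{s}}$ and $P_V$ are preradicals, and $(S_{\mathrm{Abel}}^{\mathbf{s}})^{\ast}$ and $P_V^{\circ}$ are radicals. *)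

(* Defs.v *)
From HB Require Import structures.
From mathcomp Require Import all_boot all_order all_algebra.
From mathcomp Require Import wochoice all_classical all_reals all_analysis.
From mathcomp Require Import generic_quotient ring_quotient complex ring.

Set Implicit Arguments.
Unset Strict Implicit.
Unset Printing Implicit Defensive.

Import Order.TTheory GRing.Theory Num.Theory.
Import numFieldNormedType.Exports.

Local Open Scope classical_set_scope.
Local Open Scope ring_scope.

HB.mixin Record CompleteNormedModule_isBanachLie (K : numFieldType) L
    & CompleteNormedModule K L := {
  lie : L -> L -> L;
  lie_linearl : forall (c : K) (x y z : L),
    lie (c *: x + y) z = c *: lie x z + lie y z;
  lie_linearr : forall (c : K) (x y z : L),
    lie z (c *: x + y) = c *: lie z x + lie z y;
  liexx : forall x : L, lie x x = 0;
  lie_jacobi : forall x y z : L,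
    lie x (lie y z) + lie y (lie z x) + lie z (lie x y) = 0;
  lie_bounded : exists2 t : K, 0 < t &
    forall x y : L, `|lie x y| <= t * `|x| * `|y|
}.

#[short(type="banachLieType")]
HB.structure Definition BanachLie (K : numFieldType) :=
  {L of CompleteNormedModule_isBanachLie K L & CompleteNormedModule K L}.

Section LieSubsets.
Context {K : numFieldType} {L : banachLieType K}.
Implicit Types I J A B : set L.

Definition lin_subspace A :=
  A 0 /\ forall (c : K) (x y : L), A x -> A y -> A (c *: x + y).

Definition lspan A : set L := smallest lin_subspace A.

Definition closed_lspan A : set L := closure (lspan A).

Definition lie_commutator A B : set L := lspan [set lie a b | a in A & b in B].

Definition lie_subalgebra A :=
  lin_subspace A /\ forall a b, A a -> A b -> A (lie a b).

Definition lie_ideal_in I J :=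
  [/\ I `<=` J, lin_subspace I & forall a b, J a -> I b -> I (lie a b)].

Definition lie_ideal I := lie_ideal_in I setT.

Definition lie_subideal I :=
  exists (n : nat) (J : nat -> set L),
    [/\ J 0%N = I, J n = setT,
        forall i, (i <= n)%N -> lie_subalgebra (J i) &
        forall i, (i < n)%N -> lie_ideal_in (J i) (J i.+1)].

Definition closed_subalgebra A := closed A /\ lie_subalgebra A.

Definition closed_ideal I := closed I /\ lie_ideal I.

Definition lie_commutative I := forall a b, I a -> I b -> lie a b = 0.

Definition primitive_ideal J :=
  closed_ideal J /\
  forall A, lie_subideal A -> lie_commutator A A `<=` J -> A `<=` J.

End LieSubsets.

Section BracketTheory.
Context {K : numFieldType} {L : banachLieType K}.
Implicit Types x y z : L.

Lemma lieDl x y z : lie (x + y) z = lie x z + lie y z.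
Proof. by have := lie_linearl 1 x y z; rewrite !scale1r. Qed.

Lemma lieDr x y z : lie z (x + y) = lie z x + lie z y.
Proof. by have := lie_linearr 1 x y z; rewrite !scale1r. Qed.

Lemma lie0l z : lie 0 z = 0.
Proof.
have /eqP := lieDl 0 0 z.
by rewrite addr0 -subr_eq0 opprD addNKr oppr_eq0 => /eqP.
Qed.

Lemma lie0r z : lie z 0 = 0.
Proof.
have /eqP := lieDr 0 0 z.
by rewrite addr0 -subr_eq0 opprD addNKr oppr_eq0 => /eqP.
Qed.

Lemma lieZl (c : K) x z : lie (c *: x) z = c *: lie x z.
Proof. by have := lie_linearl c x 0 z; rewrite !addr0 lie0l addr0. Qed.

Lemma lieZr (c : K) x z : lie z (c *: x) = c *: lie z x.
Proof. by have := lie_linearr c x 0 z; rewrite !addr0 lie0r addr0. Qed.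

Lemma lieC x y : lie x y = - lie y x.
Proof.
have := liexx (x + y); rewrite lieDl !lieDr !liexx add0r addr0 => /eqP.
by rewrite addr_eq0 => /eqP.
Qed.

Lemma lieBl x y z : lie (x - y) z = lie x z - lie y z.
Proof. by rewrite lieDl -scaleN1r lieZl scaleN1r. Qed.

Lemma lieBr x y z : lie z (x - y) = lie z x - lie z y.
Proof. by rewrite lieDr -scaleN1r lieZr scaleN1r. Qed.

End BracketTheory.

Section Subalgebra.
Context {K : numFieldType} {L : banachLieType K}.
Variables (S : set L) (SP : closed_subalgebra S).

Definition subalg_pred of closed_subalgebra S : {pred L} := fun x => x \in S.

Lemma subalg_submod : submod_closed (subalg_pred SP).
Proof.
have [_ [[S0 SD] _]] := SP; split; first exact/mem_set.
by move=> c x y /set_mem Sx /set_mem Sy; apply/mem_set/SD.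
Qed.

HB.instance Definition _ :=
  GRing.isSubmodClosed.Build K L (subalg_pred SP) subalg_submod.

Record subalg := Subalg { subalg_val : L; _ : subalg_val \in subalg_pred SP }.

HB.instance Definition _ := [isSub for subalg_val].
HB.instance Definition _ := [Choice of subalg by <:].
HB.instance Definition _ := [SubChoice_isSubLmodule of subalg by <:].


Let norm_sub (x : subalg) := `|val x|.

Let norm_subD x y : norm_sub (x + y) <= norm_sub x + norm_sub y.
Proof. by rewrite /norm_sub raddfD ler_normD. Qed.

Let norm_subZ (c : K) x : norm_sub (c *: x) = `|c| * norm_sub x.
Proof. by rewrite /norm_sub linearZ normrZ. Qed.

Let norm_sub0 x : norm_sub x = 0 -> x = 0.
Proof. by move=> /normr0_eq0 x0; apply: val_inj; rewrite x0 raddf0. Qed.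

HB.instance Definition _ :=
  Lmodule_isNormed.Build K subalg norm_subD norm_subZ norm_sub0.

Lemma norm_subE (x : subalg) : `|x| = `|val x|.
Proof. by []. Qed.

Let subalg_complete (F : set_system subalg) :
  ProperFilter F -> cauchy F -> cvg F.
Proof.
move=> FF /cauchy_ballP Fc.
have /cauchy_cvg/cvg_ex[l Fl] : cauchy (subalg_val @ F).
  apply/cauchy_ballP => e e0; rewrite near_map2.
  by move: (Fc e e0); rewrite -!ball_normE.
have Sl : l \in subalg_pred SP.
  have [Scl _] := SP; apply/mem_set; apply: (closed_cvg _ Scl) Fl.
  by apply: nearW => x; apply/set_mem; exact: valP.
apply/cvg_ex; exists (Subalg Sl); apply/cvgrPdist_lt => e e0.
by move/cvgrPdist_lt : Fl => /(_ e e0).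
Qed.

HB.instance Definition _ := Uniform_isComplete.Build subalg subalg_complete.

Let lie_subP (x y : subalg) : lie (val x) (val y) \in subalg_pred SP.
Proof.
have [_ [_ SL]] := SP.
by apply/mem_set/SL; apply/set_mem; exact: valP.
Qed.

Let lie_sub x y := Subalg (lie_subP x y).

Let lie_sub_linearl c x y z :
  lie_sub (c *: x + y) z = c *: lie_sub x z + lie_sub y z.
Proof. by apply: val_inj; exact: lie_linearl. Qed.

Let lie_sub_linearr c x y z :
  lie_sub z (c *: x + y) = c *: lie_sub z x + lie_sub z y.
Proof. by apply: val_inj; exact: lie_linearr. Qed.

Let lie_subxx x : lie_sub x x = 0.
Proof. by apply: val_inj; exact: liexx. Qed.

Let lie_sub_jacobi x y z :
  lie_sub x (lie_sub y z) + lie_sub y (lie_sub z x) +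
  lie_sub z (lie_sub x y) = 0.
Proof. by apply: val_inj; exact: lie_jacobi. Qed.

Let lie_sub_bounded : exists2 t : K, 0 < t &
  forall x y : subalg, `|lie_sub x y| <= t * `|x| * `|y|.
Proof.
by have [t t0 tP] := @lie_bounded K L; exists t => // x y; exact: tP.
Qed.

HB.instance Definition _ := CompleteNormedModule_isBanachLie.Build K subalg
  lie_sub_linearl lie_sub_linearr lie_subxx lie_sub_jacobi lie_sub_bounded.

Lemma lie_subE (x y : subalg) : val (lie x y) = lie (val x) (val y).
Proof. by []. Qed.

End Subalgebra.

Section Quotient.
Local Open Scope quotient_scope.
Local Open Scope complex_scope.
Context {R : realType} {L : banachLieType R[i]}.
Variables (I : set L) (IP : closed_ideal I).

Definition ideal_pred of closed_ideal I : {pred L} := fun x => x \in I.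

Lemma ideal_submod : submod_closed (ideal_pred IP).
Proof.
have [_ [_ [I0 ID] _]] := IP; split; first exact/mem_set.
by move=> c x y /set_mem Ix /set_mem Iy; apply/mem_set/ID.
Qed.

HB.instance Definition _ :=
  GRing.isSubmodClosed.Build R[i] L (ideal_pred IP) ideal_submod.

Definition lie_quot : Type := Quotient.quot (ideal_pred IP).

HB.instance Definition _ := Choice.on lie_quot.
HB.instance Definition _ := ZmodQuotient.on lie_quot.

Let Q := lie_quot.

Definition quot_map (x : L) : Q := \pi_Q x.

Lemma quot_mapD : {morph quot_map : x y / x + y}.
Proof. by move=> x y; rewrite /quot_map raddfD. Qed.

Let quot_mapB : {morph quot_map : x y / x - y}.
Proof. by move=> x y; rewrite /quot_map raddfB. Qed.

Lemma quot_map_eq x y : quot_map x = quot_map y <-> I (x - y).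
Proof.
have <- : (x - y \in ideal_pred IP) = I (x - y) :> Prop by rewrite in_setE.
rewrite Quotient.idealrBE.
by split => [E|/eqP E]; [apply/eqP; exact: E|exact: E].
Qed.

Lemma quot_map_surj (y : Q) : exists x, quot_map x = y.
Proof. by exists (repr y); exact: reprK. Qed.

Let scale_quot (c : R[i]) (y : Q) : Q := quot_map (c *: repr y).

Let quot_map_scale c x : quot_map (c *: x) = scale_quot c (quot_map x).
Proof.
apply/quot_map_eq; rewrite -scalerBr.
have [_ [_ [I0 ID] _]] := IP; rewrite -[_ *: _]addr0; apply: ID => //.
by apply/quot_map_eq; rewrite /quot_map reprK.
Qed.

Let scale_quotA a b y : scale_quot a (scale_quot b y) = scale_quot (a * b) y.
Proof. by have [x <-] := quot_map_surj y; rewrite -!quot_map_scale scalerA. Qed.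

Let scale_quot1 : left_id 1 scale_quot.
Proof.
by move=> y; have [x <-] := quot_map_surj y; rewrite -quot_map_scale scale1r.
Qed.

Let scale_quotDr : right_distributive scale_quot +%R.
Proof.
move=> c y z; have [x <-] := quot_map_surj y; have [x' <-] := quot_map_surj z.
by rewrite -quot_mapD -!quot_map_scale scalerDr quot_mapD.
Qed.

Let scale_quotDl y : {morph scale_quot^~ y : a b / a + b}.
Proof.
move=> a b; have [x <-] := quot_map_surj y.
by rewrite -!quot_map_scale scalerDl quot_mapD.
Qed.

HB.instance Definition _ := GRing.Zmodule_isLmodule.Build R[i] lie_quot
  scale_quotA scale_quot1 scale_quotDr scale_quotDl.

Lemma quot_mapZ c x : quot_map (c *: x) = c *: quot_map x.
Proof. exact: quot_map_scale. Qed.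

Definition norm_quot (y : Q) : R :=
  inf [set complex.Re `|x| | x in [set x | quot_map x = y]].

Let ReNE (x : L) : (complex.Re `|x|)%:C = `|x|.
Proof. by rewrite RRe_real. Qed.

Let ReN_ge0 (x : L) : 0 <= complex.Re `|x|.
Proof. by rewrite -lecR ReNE; exact: normr_ge0. Qed.

Let norm_quot_has_lbound y :
  has_lbound [set complex.Re `|x| | x in [set x | quot_map x = y]].
Proof. by exists 0 => _ [x _ <-]. Qed.

Let norm_quot_nonempty y :
  [set complex.Re `|x| | x in [set x | quot_map x = y]] !=set0.
Proof. by have [x xy] := quot_map_surj y; exists (complex.Re `|x|), x. Qed.

Let norm_quot_le x : norm_quot (quot_map x) <= complex.Re `|x|.
Proof. by apply: ge_inf; [exact: norm_quot_has_lbound|exists x]. Qed.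

Let norm_quot_ge0 y : 0 <= norm_quot y.
Proof.
by apply: lb_le_inf; [exact: norm_quot_nonempty|move=> _ [x _ <-]].
Qed.

Let norm_quot_lift y e : norm_quot y < e ->
  exists2 x, quot_map x = y & complex.Re `|x| < e.
Proof.
by move/inf_lt => /(_ (norm_quot_nonempty y))[_ [x xy <-]]; exists x.
Qed.

Let norm_quotD y z :
  (norm_quot (y + z))%:C <= (norm_quot y)%:C + (norm_quot z)%:C.
Proof.
rewrite -rmorphD lecR; apply/ler_addgt0Pr => e e0.
have e20 : 0 < e / 2 by rewrite divr_gt0.
have [x xy xe] : exists2 x, quot_map x = y &
    complex.Re `|x| < norm_quot y + e / 2.
  by apply: norm_quot_lift; rewrite ltrDl.
have [w wz we] : exists2 x, quot_map x = z &
    complex.Re `|x| < norm_quot z + e / 2.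
  by apply: norm_quot_lift; rewrite ltrDl.
rewrite -{1}xy -{1}wz -quot_mapD (le_trans (norm_quot_le _))//.
rewrite (@le_trans _ _ (complex.Re `|x| + complex.Re `|w|))//.
  by rewrite -lecR rmorphD/= !ReNE ler_normD.
by rewrite (le_trans (lerD (ltW xe) (ltW we)))// addrACA -splitr.
Qed.

Let norm_quotZ_le c y :
  (norm_quot (c *: y))%:C <= `|c| * (norm_quot y)%:C.
Proof.
rewrite -[`|c|]RRe_real ?normr_real// -rmorphM lecR.
have c0 : 0 <= complex.Re `|c| by rewrite -lecR RRe_real//; exact: normr_ge0.
apply/ler_addgt0Pr => e e0.
have [x xy xe] : exists2 x, quot_map x = y &
    complex.Re `|x| < norm_quot y + e / (complex.Re `|c| + 1).
  by apply: norm_quot_lift; rewrite ltrDl divr_gt0// ltr_wpDl.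
rewrite -{1}xy -quot_mapZ (le_trans (norm_quot_le _))//.
rewrite (@le_trans _ _ (complex.Re `|c| * complex.Re `|x|))//.
  by rewrite -lecR rmorphM/= !RRe_real ?normr_real// normrZ.
rewrite (le_trans (ler_wpM2l c0 (ltW xe)))// mulrDr lerD2l.
rewrite mulrCA ler_piMr// ?ltW// ltr_pdivrMr ?ltr_wpDl// mul1r ltrDl//.
Qed.

Let norm_quotZ c y :
  (norm_quot (c *: y))%:C = `|c| * (norm_quot y)%:C.
Proof.
apply/le_anti; rewrite norm_quotZ_le/=.
have [->|c0] := eqVneq c 0; first by rewrite normr0 mul0r lecR.
have := norm_quotZ_le c^-1 (c *: y); rewrite scalerA mulVf// scale1r.
by rewrite normfV mulrC ler_pdivlMr ?normr_gt0// mulrC.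
Qed.

Let norm_quot0 y : (norm_quot y)%:C = 0 -> y = 0.
Proof.
move=> /complexI y0.
have [x xy] := quot_map_surj y; rewrite -xy.
have <- : quot_map 0 = 0 by rewrite /quot_map raddf0.
apply/quot_map_eq; rewrite subr0; have [Icl _] := IP.
apply: Icl => B /nbhs_ballP[e/= e0 eB].
have [w wy we] : exists2 w, quot_map w = y & complex.Re `|w| < complex.Re e.
  by apply: norm_quot_lift; rewrite y0 -ltcR RRe_real// gtr0_real.
exists (x - w); split; first by apply/quot_map_eq; rewrite xy wy.
apply: eB; rewrite -ball_normE/= opprB addrCA subrr addr0.
by rewrite -ReNE -[e]RRe_real ?gtr0_real// ltcR.
Qed.

HB.instance Definition _ :=
  Lmodule_isNormed.Build R[i] lie_quot norm_quotD norm_quotZ norm_quot0.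

Lemma norm_quotE (y : lie_quot) : `|y| = (norm_quot y)%:C.
Proof. by []. Qed.

Let norm_quot_map x : `|quot_map x| <= `|x|.
Proof. by rewrite norm_quotE -ReNE lecR. Qed.

Let quot_lift (y : Q) (e : R[i]) : `|y| < e ->
  exists2 x, quot_map x = y & `|x| < e.
Proof.
move=> ye; have eE : (complex.Re e)%:C = e.
  by rewrite RRe_real// gtr0_real// (le_lt_trans _ ye).
move: ye; rewrite -eE norm_quotE ltcR => /norm_quot_lift[x xy xe].
by exists x => //; rewrite -ReNE ltcR.
Qed.

Let geo n : R[i] := 2^-1 ^+ n.

Let geo_gt0 n : 0 < geo n. Proof. by rewrite exprn_gt0// invr_gt0. Qed.

Let geo_small (e : R[i]) : 0 < e -> \forall n \near \oo, geo n < e.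
Proof.
move=> e0; have eE : (complex.Re e)%:C = e by rewrite RRe_real// gtr0_real.
have e0' : 0 < complex.Re e by rewrite -ltcR eE.
near=> n; rewrite -eE /geo.
have -> : 2^-1 = (2^-1 : R)%:C by rewrite fmorphV rmorph_nat.
rewrite -rmorphXn ltcR exprVn -div1r.
near: n; exact: (@near_infty_natSinv_expn_lt R (PosNum e0')).
Unshelve. all: by end_near. Qed.

Let quot_complete (F : set_system Q) : ProperFilter F -> cauchy F -> cvg F.
Proof.
move=> FF /cauchyP Fc.
have /choice[c cP] n : exists x, F (ball x (geo n)) by exact/Fc/geo_gt0.
have cB n : `|c n.+1 - c n| < geo n.+1 + geo n.
  near F => y; rewrite -(subrK y (c n.+1)) -addrA.
  rewrite (le_lt_trans (ler_normD _ _))// ltrD//.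
    by near: y; move: (cP n.+1); rewrite -ball_normE.
  by rewrite distrC; near: y; move: (cP n); rewrite -ball_normE.
have /choice[x xP] n : exists x, quot_map x = c n.+1 - c n /\
    `|x| < geo n.+1 + geo n.
  by have [x] := quot_lift (cB n); exists x.
have [x0 x0P] := quot_map_surj (c 0%N).
pose s n := x0 + series x n.
have sP n : quot_map (s n) = c n.
  rewrite /s /series/=; elim: n => [|n IH]; first by rewrite big_geq// addr0.
  by rewrite big_nat_recr//= addrA quot_mapD IH (xP n).1 addrC subrK.
have gS m n : (m <= n)%N ->
    \sum_(m <= k < n) (geo k.+1 + geo k) <= 3 * geo m.
  move=> mn; have geoS k : geo k.+1 + geo k = 3 * geo k - 3 * geo k.+1.
    rewrite /geo exprS; set g := _ ^+ k; have : g = 2 * (2^-1 * g).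
      by rewrite mulrA mulfV ?mul1r// pnatr_eq0.
    set h := 2^-1 * g => ->; ring.
  under eq_bigr do rewrite geoS -opprB.
  rewrite sumrN telescope_sumr// opprB gerDl oppr_le0 mulr_ge0//.
  exact/ltW.
have : cauchy (series x @ \oo).
  apply/cauchy_seriesP => e e0.
  have e30 : 0 < e / 3 by rewrite divr_gt0.
  rewrite -near2_pair.
  near=> m n => /=; have [mn|/ltnW nm] := leqP m n; last first.
    by rewrite big_geq// normr0.
  rewrite (le_lt_trans (ler_norm_sum _ _ _))//.
  rewrite (@le_lt_trans _ _ (3 * geo m))//; last first.
    by rewrite mulrC -ltr_pdivlMr//; near: m; exact: geo_small.
  rewrite (le_trans _ (gS _ _ mn))// ler_sum// => k _.
  by rewrite ltW// (xP k).2.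
move=> /cauchy_cvg/cvg_ex[l sl].
have {}sl : s @ \oo --> x0 + l by apply: cvgD => //; exact: cvg_cst.
apply/cvg_ex; exists (quot_map (x0 + l)); apply/cvgrPdist_lt => e e0.
have e20 : 0 < e / 2 by rewrite divr_gt0.
near \oo => n.
have sn : `|x0 + l - s n| < e / 2.
  by near: n; move/cvgrPdist_lt : sl; exact.
have gn : geo n < e / 2 by near: n; exact: geo_small.
near=> y; rewrite (splitr e) -(subrK (c n) (quot_map _)) -addrA.
rewrite (le_lt_trans (ler_normD _ _))// ltrD//.
  by rewrite -sP -quot_mapB (le_lt_trans (norm_quot_map _)).
apply: lt_trans gn; near: y; move: (cP n); by rewrite -ball_normE.
Unshelve. all: by end_near. Qed.

HB.instance Definition _ := Uniform_isComplete.Build lie_quot quot_complete.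

Let ideal_l x a : I a -> I (lie x a).
Proof. by have [_ [_ _]] := IP; apply. Qed.

Let ideal_r x a : I a -> I (lie a x).
Proof.
have [_ [_ [I0 ID] _]] := IP => /(@ideal_l x) Ixa.
by rewrite lieC -scaleN1r -[_ *: _]addr0; exact: ID.
Qed.

Definition lie_quot_bracket (y z : Q) : Q := quot_map (lie (repr y) (repr z)).

Let bracketE x w :
  lie_quot_bracket (quot_map x) (quot_map w) = quot_map (lie x w).
Proof.
have rE v : I (repr (quot_map v) - v) by apply/quot_map_eq; exact: reprK.
have q0 v : I v -> quot_map v = 0.
  move=> Iv; have <- : quot_map 0 = 0 by rewrite /quot_map raddf0.
  by apply/quot_map_eq; rewrite subr0.
rewrite /lie_quot_bracket -(subrK w (repr (quot_map w))).
rewrite -(subrK x (repr (quot_map x))).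
move: (rE x) (rE w); set a := _ - x; set b := _ - w => Ia Ib.
clearbody a b; rewrite lieDr !lieDl !quot_mapD (q0 _ (ideal_r w Ia)).
by rewrite !(q0 _ (ideal_l _ Ib)) !add0r.
Qed.

Let bracket_linearl c x y z : lie_quot_bracket (c *: x + y) z =
  c *: lie_quot_bracket x z + lie_quot_bracket y z.
Proof.
have [a <-] := quot_map_surj x; have [b <-] := quot_map_surj y.
have [d <-] := quot_map_surj z.
by rewrite -quot_mapZ -quot_mapD !bracketE lie_linearl quot_mapD quot_mapZ.
Qed.

Let bracket_linearr c x y z : lie_quot_bracket z (c *: x + y) =
  c *: lie_quot_bracket z x + lie_quot_bracket z y.
Proof.
have [a <-] := quot_map_surj x; have [b <-] := quot_map_surj y.
have [d <-] := quot_map_surj z.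
by rewrite -quot_mapZ -quot_mapD !bracketE lie_linearr quot_mapD quot_mapZ.
Qed.

Let bracketxx x : lie_quot_bracket x x = 0.
Proof.
have [a <-] := quot_map_surj x.
by rewrite bracketE liexx /quot_map raddf0.
Qed.

Let bracket_jacobi x y z :
  lie_quot_bracket x (lie_quot_bracket y z) +
  lie_quot_bracket y (lie_quot_bracket z x) +
  lie_quot_bracket z (lie_quot_bracket x y) = 0.
Proof.
have [a <-] := quot_map_surj x; have [b <-] := quot_map_surj y.
have [d <-] := quot_map_surj z.
by rewrite !bracketE -!quot_mapD lie_jacobi /quot_map raddf0.
Qed.

Let bracket_bounded : exists2 t : R[i], 0 < t &
  forall x y : lie_quot, `|lie_quot_bracket x y| <= t * `|x| * `|y|.
Proof.
have [t t0 tP] := @lie_bounded _ L; exists t => // x y.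
have step (u : L) (w : Q) :
    `|lie_quot_bracket (quot_map u) w| <= t * `|u| * `|w|.
  apply/ler_addgt0Pr => e e0.
  have tu0 : 0 <= t * `|u| by rewrite mulr_ge0// ltW.
  have d0 : 0 < e / (t * `|u| + 1) by rewrite divr_gt0// ltr_wpDl.
  have [v <- ve] : exists2 v, quot_map v = w & `|v| < `|w| + e / (t * `|u| + 1).
    by apply: quot_lift; rewrite ltrDl.
  rewrite bracketE (le_trans (norm_quot_map _))// (le_trans (tP _ _))//.
  rewrite (le_trans (ler_wpM2l tu0 (ltW ve)))// mulrDr lerD2l.
  by rewrite mulrCA ler_piMr// ?ltW// ltr_pdivrMr ?ltr_wpDl// mul1r ltrDl.
apply/ler_addgt0Pr => e e0.
have ty0 : 0 <= t * `|y| by rewrite mulr_ge0// ltW.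
have d0 : 0 < e / (t * `|y| + 1) by rewrite divr_gt0// ltr_wpDl.
have [v <- ve] : exists2 v, quot_map v = x & `|v| < `|x| + e / (t * `|y| + 1).
  by apply: quot_lift; rewrite ltrDl.
rewrite (le_trans (step _ _))// mulrAC.
rewrite [leRHS](_ : _ = t * `|y| * `|quot_map v| + e); last by rewrite mulrAC.
rewrite (le_trans (ler_wpM2l ty0 (ltW ve)))// mulrDr lerD2l.
by rewrite mulrCA ler_piMr// ?ltW// ltr_pdivrMr ?ltr_wpDl// mul1r ltrDl.
Qed.

HB.instance Definition _ :=
  CompleteNormedModule_isBanachLie.Build R[i] lie_quot
    bracket_linearl bracket_linearr bracketxx bracket_jacobi bracket_bounded.

Lemma quot_map_lie x w : quot_map (lie x w) = lie (quot_map x) (quot_map w).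
Proof. exact/esym/bracketE. Qed.

End Quotient.

(* Points of a well-ordered type stand for ordinals; [transfinite w] is the
   [w]-th term of the sequence with first term [base], successor step [next]
   and limit step [lim] (applied to the set of all earlier terms). *)
Section Transfinite.
Context {X : Type}.
Variables (base : X) (next : X -> X) (lim : set X -> X).
Context {W : eqType} {le : rel W}.
Variable (wo : well_order le).

Let lt v w := (v != w) && le v w.

Let le_anti : antisymmetric le.
Proof.
move=> v w; apply: (@wo_chain_antisymmetric W le predT) => //.
by move=> A _; exact: wo.
Qed.

Let wo_min (P : W -> Prop) : (exists w, P w) ->
  exists w, P w /\ forall v, P v -> le w v.
Proof.
move=> [w Pw]; have [|m [[/asboolP Pm mP] _]] := wo (A := fun w => `[<P w>]).
  by exists w; exact/asboolP.
by exists m; split=> // v Pv; apply: mP; exact/asboolP.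
Qed.

Let lt_wf : well_founded lt.
Proof.
move=> w; apply: contrapT => wN.
have [m [mN mP]] := wo_min (ex_intro (fun w => ~ Acc lt w) w wN).
apply: mN; constructor => v /andP[vm vlem]; apply: contrapT => /mP mv.
by move: vm; rewrite (le_anti (x := v) (y := m)) ?vlem ?eqxx.
Qed.

(* [w] is the successor of [v] *)
Definition covers v w := lt v w /\ forall u, lt u w -> le u v.

Let step (w : W) (rec : forall v, lt v w -> X) : X :=
  match pselect (exists v, covers v w) with
  | left e => let: exist _ vw := cid e in next (rec _ (proj1 vw))
  | right _ =>
      if pselect (exists v, lt v w) then
        lim [set y | exists v (vw : lt v w), y = rec v vw]
      else base
  end.

Definition transfinite : W -> X := Fix lt_wf (fun=> X) step.

Let transfiniteE w : transfinite w = step (fun v (_ : lt v w) => transfinite v).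
Proof.
rewrite /transfinite Fix_eq// => v f g fg.
by congr step; do 2 apply: functional_extensionality_dep => ?.
Qed.

Lemma transfinite_base w : (forall v, le w v) -> transfinite w = base.
Proof.
move=> wmin; rewrite transfiniteE /step.
have wN v : ~ lt v w.
  move=> /andP[vw vlew].
  by move: vw; rewrite (le_anti (x := v) (y := w)) ?eqxx// vlew wmin.
case: pselect => [e|_]; first by have [v [/wN]] := e.
by case: pselect => // e; have [v /wN] := e.
Qed.

Lemma transfinite_next v w : covers v w -> transfinite w = next (transfinite v).
Proof.
move=> vw; rewrite transfiniteE /step.
case: pselect => [e|[]]; last by exists v.
case: (cid e) => u uw; congr (next (transfinite _)).
apply: le_anti; apply/andP; split.
  by have [_] := vw; apply; case: uw.
by have [_] := uw; apply; case: vw.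
Qed.

Lemma transfinite_lim w : (exists v, lt v w) -> ~ (exists v, covers v w) ->
  transfinite w = lim (transfinite @` [set v | lt v w]).
Proof.
move=> wpos wlim; rewrite transfiniteE /step.
case: pselect => [e|_]; first by case: wlim.
case: (pselect (exists v, lt v w)) => // ?.
congr lim; apply/seteqP; split=> y; first by move=> [v [vw ->]]; exists v.
by move=> [v vw <-]; exists v, vw.
Qed.

End Transfinite.

(* The value at which the sequence [transfinite base next lim] of subsets of [T]
   stabilizes, i.e. its term fixed by [next]; for the monotone sequences below
   all later terms are then equal to it. *)
Definition stable_value {T : Type} (base : set T) (next : set T -> set T)
    (lim : set (set T) -> set T) : set T :=
  [set x | exists (W : eqType) (le : rel W) (wo : well_order le) (w : W),
     let A := transfinite base next lim wo w in next A = A /\ A x].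

Section Radicals.
Context {R : realType}.

Definition lie_map := forall L : banachLieType R[i], set L.

Implicit Type P : lie_map.

(* P(A) for a closed subalgebra A of L, as a subset of L (set0 for other A) *)
Definition map_sub P (L : banachLieType R[i]) (A : set L) : set L :=
  [set x | exists AP : closed_subalgebra A, (val @` P (subalg AP)) x].

(* The preimage of P(L / I) in L for a closed ideal I of L (set0 for other I) *)
Definition map_quot P (L : banachLieType R[i]) (I : set L) : set L :=
  [set x | exists IP : closed_ideal I, P (lie_quot IP) (quot_map IP x)].

Definition map_circ P : lie_map := fun L =>
  stable_value setT (@map_sub P L) (fun F => \bigcap_(A in F) A).

Definition map_star P : lie_map := fun L =>
  stable_value [set 0] (@map_quot P L) (fun F => closure (\bigcup_(A in F) A)).

Definition map_s P : lie_map := fun L =>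
  closed_lspan (\bigcup_(I in [set I | [/\ closed I, lie_subideal I &
                                         map_sub P I = I]]) I).

Definition S_Abel : lie_map := fun L =>
  closed_lspan (\bigcup_(I in [set I | closed_ideal I /\ lie_commutative I]) I).

Definition P_V : lie_map := fun L => \bigcap_(J in primitive_ideal) J.

End Radicals.

Arguments map_circ {R} P L _.
Arguments map_star {R} P L _.
Arguments map_s {R} P L _.
Arguments S_Abel {R} L _.
Arguments P_V {R} L _.

(* Main.v *)
Require Import Defs.
From mathcomp Require Import all_boot all_order all_algebra.
From mathcomp Require Import wochoice all_classical all_reals all_analysis.
From mathcomp Require Import complex ring.

(** Both sides equal [P_V L], which is the least primitive ideal of [L] because
    an intersection of primitive ideals is primitive ([P_V_primitive]).

    Small exponentials of a bounded derivation [D] are bounded Lie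
    automorphisms, and [D] is their derivative; so a closed subspace defined
    canonically from the Lie structure is stable under all bounded derivations
    ([derivation_invariant]). This applies to [P_V L] and to the closed span
    [abelian_span L] of the commutative closed subideals, and the latter is
    [map_s S_Abel L] ([map_s_S_AbelE]), which is therefore an ideal.

    For [map_circ P_V]: let [J] be a primitive ideal of [L]. The traces on [J] of
    primitive ideals of [L] are primitive in [J], so [P_V J] is contained in
    [P_V L]. Conversely [P_V J] is stable under the derivations [ad x] of [J],
    hence an ideal of [L]; it is primitive in [L] because a subideal [A] of [L]
    with [[A, A]] in [P_V J] lies in [J] and is then a subideal of [J]. Thus
    [P_V J = P_V L] ([map_sub_P_V]). With [J = L] and [J = P_V L] this shows that
    the decreasing chain is [L], [P_V L], [P_V L], and so on.

    For [map_star (map_s S_Abel)]: every term of the increasing chain is a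
    closed ideal contained in every primitive ideal [J], since a commutative
    subideal of [L / I], with [I] contained in [J], lifts to a subideal [A] with
    [[A, A]] in [J], so that [A] is contained in [J]. At a term [I] where the
    chain stabilizes, [L / I] has no nonzero commutative subideals, which says
    that [I] is primitive ([map_quot_fixed]). So that term is [P_V L]. It exists
    by Cantor's theorem: over a well-ordered set larger than the set of subsets
    of [L] the chain cannot be strictly increasing ([increasing_chain_fixed]). *)

Set Implicit Arguments.
Unset Strict Implicit.
Unset Printing Implicit Defensive.

Import Order.TTheory GRing.Theory Num.Theory.
Import numFieldNormedType.Exports.

Local Open Scope classical_set_scope.
Local Open Scope ring_scope.

(** * Subspaces and closures *)

Section Closure.
Context {K : numFieldType} {V : normedModType K}.

Lemma closureP (A : set V) x :
  closure A x <-> forall e : K, 0 < e -> exists2 y, A y & `|x - y| < e.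
Proof.
split=> [clx e e0|clx B /nbhs_ballP[e/= e0 eB]].
  have [y [Ay xy]] := clx _ (nbhsx_ballx x e e0).
  by exists y => //; move: xy; rewrite -ball_normE.
have [y Ay xy] := clx e e0.
by exists y; split => //; apply: eB; rewrite -ball_normE.
Qed.

Lemma closed_singleton (x : V) : closed [set x].
Proof.
exact: accessible_closed_set1 (hausdorff_accessible (@norm_hausdorff K V)) x.
Qed.

End Closure.

Section Subspaces.
Context {K : numFieldType} {L : banachLieType K}.
Implicit Types (A B I J V : set L).

Lemma lin_subspaceD V x y : lin_subspace V -> V x -> V y -> V (x + y).
Proof. by move=> [_ VD] Vx Vy; rewrite -[x]scale1r; exact: VD. Qed.

Lemma lin_subspaceZ V c x : lin_subspace V -> V x -> V (c *: x).
Proof. by move=> [V0 VD] Vx; rewrite -[_ *: _]addr0; exact: VD. Qed.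

Lemma lin_subspaceN V x : lin_subspace V -> V x -> V (- x).
Proof. by move=> sV Vx; rewrite -scaleN1r; exact: lin_subspaceZ. Qed.

Lemma lin_subspaceB V x y : lin_subspace V -> V x -> V y -> V (x - y).
Proof.
by move=> sV Vx Vy; apply: lin_subspaceD => //; exact: lin_subspaceN.
Qed.

Lemma lspan_subspace A : lin_subspace (lspan A).
Proof.
split=> [B [[]]//|c x y Ax Ay B BP]; have [[_ BD] _] := BP.
by apply: BD; [exact: Ax|exact: Ay].
Qed.

Lemma sub_lspan A : A `<=` lspan A.
Proof. by move=> x Ax B [_]; exact. Qed.

Lemma lspan_min A V : lin_subspace V -> A `<=` V -> lspan A `<=` V.
Proof. by move=> sV AV x; apply. Qed.

Lemma closure_subspace V : lin_subspace V -> lin_subspace (closure V).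
Proof.
move=> sV; split; first by apply: subset_closure; case: sV.
move=> c x y /closureP clx /closureP cly; apply/closureP => e e0.
have c1 : 0 < `|c| + 1 by rewrite ltr_wpDl.
have e2 : 0 < e / 2 by rewrite divr_gt0.
have [x' Vx' xx'] := clx _ (divr_gt0 e2 c1).
have [y' Vy' yy'] := cly _ e2.
exists (c *: x' + y'); first by case: sV => _; apply.
rewrite opprD addrACA -scalerBr (le_lt_trans (ler_normD _ _))// (splitr e).
rewrite ler_ltD// normrZ (@le_trans _ _ ((`|c| + 1) * `|x - x'|))//.
  by rewrite ler_wpM2r// lerDl.
by rewrite mulrC -ler_pdivlMr// ltW.
Qed.

Lemma closure_min A V : closed V -> A `<=` V -> closure A `<=` V.
Proof. by move=> cV AV; rewrite closureE => x; apply. Qed.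

Lemma closed_lspan_subspace A : lin_subspace (closed_lspan A).
Proof. exact/closure_subspace/lspan_subspace. Qed.

Lemma closed_lspan_closed A : closed (closed_lspan A).
Proof. exact: closed_closure. Qed.

Lemma sub_closed_lspan A : A `<=` closed_lspan A.
Proof. by move=> x Ax; apply: subset_closure; exact: sub_lspan. Qed.

Lemma closed_lspan_min A V :
  closed V -> lin_subspace V -> A `<=` V -> closed_lspan A `<=` V.
Proof. by move=> cV sV AV; apply: closure_min => //; exact: lspan_min. Qed.

Lemma lie_commutator_sub A B V : lin_subspace V ->
  lie_commutator A B `<=` V <-> forall a b, A a -> B b -> V (lie a b).
Proof.
move=> sV; split=> [ABV a b Aa Bb|ABV].
  by apply: ABV; apply: sub_lspan; exists a => //; exists b.
by apply: lspan_min => // _ [a Aa [b Bb <-]]; exact: ABV.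
Qed.

(** The bracket being continuous, relations [[A, B]] in [C] pass to closures. *)
Lemma lie_closure A B (C : set L) : (forall a b, A a -> B b -> C (lie a b)) ->
  forall a b, closure A a -> closure B b -> closure C (lie a b).
Proof.
move=> ABC a b /closureP cla /closureP clb; apply/closureP => e e0.
have [t t0 tP] := @lie_bounded K L.
have B1 : 0 < t * (`|b| + 1) by rewrite mulr_gt0// ltr_wpDl.
have e2 : 0 < e / 2 by rewrite divr_gt0.
have [a' Aa' aa'] := cla _ (divr_gt0 e2 B1).
have A1 : 0 < t * `|a'| + 1 by rewrite ltr_wpDl// mulr_ge0// ltW.
have [b' Bb' bb'] := clb _ (divr_gt0 e2 A1).
exists (lie a' b'); first exact: ABC.
have -> : lie a b - lie a' b' = lie (a - a') b + lie a' (b - b').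
  by rewrite lieBl lieBr addrA subrK.
rewrite (le_lt_trans (ler_normD _ _))// (splitr e) ltr_leD//.
  rewrite (le_lt_trans (tP _ _))// mulrAC.
  rewrite (@le_lt_trans _ _ (t * (`|b| + 1) * `|a - a'|))//.
    by rewrite ler_wpM2r// ler_wpM2l ?ltW// ltrDl.
  by rewrite mulrC -ltr_pdivlMr.
rewrite (le_trans (tP _ _))//.
rewrite (@le_trans _ _ ((t * `|a'| + 1) * `|b - b'|))//.
  by rewrite ler_wpM2r// lerDl.
by rewrite mulrC -ler_pdivlMr// ltW.
Qed.

Lemma closure_commutative A : lie_commutative A -> lie_commutative (closure A).
Proof.
move=> cA a b Aa Ab; apply: (@closed_singleton K L 0).
by apply: (lie_closure (A := A) (B := A)) => // u v Au Av; exact: cA.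
Qed.

End Subspaces.
(** * Homomorphisms, ideals and subideals *)

Section Homomorphisms.
Context {K : numFieldType} {L M : banachLieType K}.
Implicit Types (f : L -> M) (A I J : set L) (B C : set M).

(** A Lie homomorphism is a map that is linear and preserves the bracket;
    boundedness is a separate property. *)
Definition lie_hom f :=
  (forall (c : K) (x y : L), f (c *: x + y) = c *: f x + f y) /\
  (forall x y : L, f (lie x y) = lie (f x) (f y)).

(** For linear maps this is continuity. *)
Definition norm_bounded f :=
  exists2 C : K, 0 < C & forall x, `|f x| <= C * `|x|.

Lemma lie_hom0 f : lie_hom f -> f 0 = 0.
Proof.
by move=> [fD _]; have := fD (-1) 0 0; rewrite scaler0 addr0 scaleN1r addNr.
Qed.

Lemma lie_homB f x y : lie_hom f -> f (x - y) = f x - f y.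
Proof.
by move=> [fD _]; rewrite addrC -scaleN1r fD scaleN1r addrC.
Qed.

Lemma preimage_subspace f B :
  lie_hom f -> lin_subspace B -> lin_subspace (f @^-1` B).
Proof.
move=> fh [B0 BD]; split; first by rewrite /preimage/= lie_hom0.
by move=> c x y Bx By; rewrite /preimage/= fh.1; exact: BD.
Qed.

Lemma preimage_subalgebra f B :
  lie_hom f -> lie_subalgebra B -> lie_subalgebra (f @^-1` B).
Proof.
move=> fh [sB BL]; split; first exact: preimage_subspace.
by move=> x y Bx By; rewrite /preimage/= fh.2; exact: BL.
Qed.

Lemma preimage_ideal f B C :
  lie_hom f -> lie_ideal_in B C -> lie_ideal_in (f @^-1` B) (f @^-1` C).
Proof.
move=> fh [BC sB CB]; split.
- by move=> x; exact: BC.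
- exact: preimage_subspace.
- by move=> x y Cx By; rewrite /preimage/= fh.2; exact: CB.
Qed.

Lemma preimage_subideal f B :
  lie_hom f -> lie_subideal B -> lie_subideal (f @^-1` B).
Proof.
move=> fh [n [J [J0 Jn sJ iJ]]]; exists n, (fun i => f @^-1` (J i)); split.
- by rewrite J0.
- by rewrite Jn.
- by move=> i /sJ; exact: preimage_subalgebra.
- by move=> i /iJ; exact: preimage_ideal.
Qed.

Lemma preimage_closed f B :
  lie_hom f -> norm_bounded f -> closed B -> closed (f @^-1` B).
Proof.
move=> fh [C C0 fC] cB x /closureP clx; apply: cB; apply/closureP => e e0.
have [y By xy] := clx _ (divr_gt0 e0 C0).
exists (f y) => //; rewrite -lie_homB// (le_lt_trans (fC _))//.
by rewrite mulrC -ltr_pdivlMr.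
Qed.

Lemma preimage_closed_ideal f B : lie_hom f -> norm_bounded f ->
  closed_ideal B -> closed_ideal (f @^-1` B).
Proof.
move=> fh fb [cB iB]; split; first exact: preimage_closed.
exact: (preimage_ideal fh iB).
Qed.

Lemma image_subspace f A :
  lie_hom f -> lin_subspace A -> lin_subspace (f @` A).
Proof.
move=> fh [A0 AD]; split; first by exists 0 => //; exact: lie_hom0.
move=> c _ _ [x Ax <-] [y Ay <-]; exists (c *: x + y); first exact: AD.
exact: fh.1.
Qed.

Lemma image_subalgebra f A :
  lie_hom f -> lie_subalgebra A -> lie_subalgebra (f @` A).
Proof.
move=> fh [sA AL]; split; first exact: image_subspace.
move=> _ _ [x Ax <-] [y Ay <-]; exists (lie x y); first exact: AL.
exact: fh.2.
Qed.

Lemma image_ideal f I J :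
  lie_hom f -> lie_ideal_in I J -> lie_ideal_in (f @` I) (f @` J).
Proof.
move=> fh [IJ sI JI]; split.
- exact: image_subset.
- exact: image_subspace.
- move=> _ _ [x Jx <-] [y Iy <-]; exists (lie x y); first exact: JI.
  exact: fh.2.
Qed.

Lemma image_subideal f A : lie_hom f -> (forall y, exists x, f x = y) ->
  lie_subideal A -> lie_subideal (f @` A).
Proof.
move=> fh fsurj [n [J [J0 Jn sJ iJ]]]; exists n, (fun i => f @` (J i)); split.
- by rewrite J0.
- rewrite Jn; apply/seteqP; split=> // y _.
  by have [x xy] := fsurj y; exists x.
- by move=> i /sJ; exact: image_subalgebra.
- by move=> i /iJ; exact: image_ideal.
Qed.

End Homomorphisms.

Section Subideals.
Context {K : numFieldType} {L : banachLieType K}.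
Implicit Types A I J : set L.

Lemma setT_subalgebra : lie_subalgebra [set: L].
Proof. by []. Qed.

Lemma ideal_subalgebra I : lie_ideal I -> lie_subalgebra I.
Proof. by move=> [_ sI iI]; split=> // a b _; exact: iI. Qed.

Lemma closed_ideal_subalgebra I : closed_ideal I -> closed_subalgebra I.
Proof. by move=> [cI /ideal_subalgebra]. Qed.

Lemma ideal_subideal I : lie_ideal I -> lie_subideal I.
Proof.
move=> iI; exists 1%N, (fun i => if i is 0%N then I else setT); split=> //.
- by case=> [_|i _]; [exact: ideal_subalgebra|exact: setT_subalgebra].
- by case.
Qed.

Lemma subideal_subalgebra A : lie_subideal A -> lie_subalgebra A.
Proof. by move=> [n [J [<- _ sJ _]]]; exact: sJ. Qed.

Lemma closure_subideal A : lie_subideal A -> lie_subideal (closure A).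
Proof.
move=> [n [J [J0 Jn sJ iJ]]]; exists n, (fun i => closure (J i)); split.
- by rewrite J0.
- by rewrite Jn closureT.
- move=> i /sJ[s sL]; split; first exact: closure_subspace.
  exact: lie_closure.
- move=> i /iJ[ss s sL]; split; first exact: closure_subset.
    exact: closure_subspace.
  exact: lie_closure.
Qed.

End Subideals.

Section SubalgebraEmbedding.
Context {K : numFieldType} {L : banachLieType K}.
Variables (S : set L) (SP : closed_subalgebra S).
Implicit Types B : set (subalg SP).

Lemma val_lie_hom : lie_hom (val : subalg SP -> L).
Proof. by split=> // c x y; rewrite linearP. Qed.

Lemma val_bounded : norm_bounded (val : subalg SP -> L).
Proof. by exists 1 => // x; rewrite mul1r norm_subE. Qed.

Lemma subalg_valP (x : subalg SP) : S (val x).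
Proof. exact/set_mem/(valP x). Qed.

Lemma subalg_lift x : S x -> exists y : subalg SP, val y = x.
Proof.
move=> Sx; have xS : x \in subalg_pred SP by exact/mem_set.
by exists (Subalg xS).
Qed.

Lemma val_closed B : closed B -> closed ((val : subalg SP -> L) @` B).
Proof.
move=> cB x clx.
have Sx : S x.
  have [cS _] := SP; apply: cS; apply: closure_subset clx => _ [y _ <-].
  exact: subalg_valP.
have [y yx] := subalg_lift Sx; exists y => //.
apply: cB; apply/closureP => e e0.
have [_ [z Bz <-] xz] := (closureP _ _).1 clx e e0.
by exists z => //; rewrite norm_subE raddfB/= yx.
Qed.

(** A subideal of a subideal is a subideal: the two chains are concatenated. *)
Lemma val_subideal B : lie_subideal S -> lie_subideal B ->
  lie_subideal ((val : subalg SP -> L) @` B).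
Proof.
move=> [m [I [I0 Im sI iI]]] [n [J [J0 Jn sJ iJ]]].
have valT : (val : subalg SP -> L) @` setT = S.
  apply/seteqP; split=> [_ [y _ <-]|x /subalg_lift[y yx]].
    exact: subalg_valP.
  by exists y.
exists (n + m)%N, (fun i => if (i < n)%N then val @` (J i) else I (i - n)%N).
split.
- case: ltnP => [|n0]; first by rewrite J0.
  move: n0; rewrite leqn0 => /eqP n0.
  have -> : B = setT by rewrite -J0 -Jn n0.
  by rewrite valT n0 I0.
- by rewrite ltnNge leq_addr/= addKn.
- move=> i inm; case: ltnP => [i_n|ni].
    exact/(image_subalgebra val_lie_hom)/sJ/ltnW.
  by apply: sI; rewrite leq_subLR.
- move=> i inm; case: (ltngtP i.+1 n) => [i_n|ni|i_n].
  + exact/(image_ideal val_lie_hom)/iJ/ltnW.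
  + by rewrite subSn//; apply: iI; rewrite ltn_subLR.
  + have i_lt : (i < n)%N by rewrite -i_n.
    have := image_ideal val_lie_hom (iJ i i_lt).
    by rewrite i_n Jn valT subnn I0.
Qed.

End SubalgebraEmbedding.

(** * Geometric convergence *)

Section GeometricConvergence.
Context {R : realType}.
Local Notation C := R[i].

Lemma half_expn_small (e : C) : 0 < e -> exists N, 2^-1 ^+ N < e.
Proof.
move=> e0; have eE : (complex.Re e)%:C%C = e by rewrite RRe_real// gtr0_real.
have e0' : 0 < complex.Re e by rewrite -ltcR eE.
have [N _ /(_ N (leqnn N))] := @near_infty_natSinv_expn_lt R (PosNum e0').
move=> /= Ne; exists N; rewrite -eE.
have -> : 2^-1 = (2^-1 : R)%:C%C by rewrite fmorphV rmorph_nat.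
by rewrite -rmorphXn ltcR exprVn -div1r.
Qed.

Lemma ler_half_expn_eq0 (x M : C) : 0 <= x ->
  (forall N, x <= M * 2^-1 ^+ N) -> x = 0.
Proof.
move=> x0 xM; apply/eqP; apply: contraT => xneq0.
have {xneq0} x_gt0 : 0 < x by rewrite lt0r xneq0.
have M0 : 0 < M by have := xM 0%N; rewrite expr0 mulr1; exact: lt_le_trans.
have [N] := half_expn_small (divr_gt0 x_gt0 M0).
rewrite ltr_pdivlMr// mulrC => /(le_lt_trans (xM N)).
by rewrite ltxx.
Qed.

Context {V : completeNormedModType C}.
Implicit Types (u v : nat -> V) (l : V).

Lemma geometric_cvg u (M q : C) : 0 <= M -> 0 <= q -> q <= 2^-1 ->
  (forall n, `|u n.+1 - u n| <= M * q ^+ n) ->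
  forall N, `|lim (u @ \oo) - u N| <= 2 * M * q ^+ N.
Proof.
move=> M0 q0 q2 uM.
have qn0 n : 0 <= q ^+ n by exact: exprn_ge0.
have uD m k : `|u (m + k)%N - u m| <= 2 * M * q ^+ m - 2 * M * q ^+ (m + k).
  elim: k => [|k IH]; first by rewrite addn0 !subrr normr0.
  rewrite addnS -(subrK (u (m + k)%N) (u _.+1)) -addrA.
  rewrite (le_trans (ler_normD _ _))// (le_trans (lerD (uM _) IH))//.
  have h : q * q ^+ (m + k) <= 2^-1 * q ^+ (m + k) by rewrite ler_wpM2r.
  rewrite -subr_ge0 exprS; set b := q ^+ (m + k) in h *.
  have -> : 2 * M * q ^+ m - 2 * M * (q * b) -
      (M * b + (2 * M * q ^+ m - 2 * M * b)) = 2 * M * (2^-1 * b - q * b).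
    by field.
  by rewrite mulr_ge0 ?mulr_ge0// subr_ge0.
have {}uD m n : (m <= n)%N -> `|u n - u m| <= 2 * M * q ^+ m.
  move=> /subnKC <-; rewrite (le_trans (uD _ _))// gerBl.
  by rewrite !mulr_ge0.
have cu : cvg (u @ \oo).
  apply: cauchy_cvg; apply/cauchyP => e e0.
  have M1 : 0 < 2 * M + 1 by rewrite ltr_wpDl// mulr_ge0.
  have [N Ne] := half_expn_small (divr_gt0 e0 M1).
  exists (u N), N => // n /= Nn; rewrite -ball_normE/= distrC.
  rewrite (le_lt_trans (uD _ _ Nn))//.
  rewrite (@le_lt_trans _ _ ((2 * M + 1) * 2^-1 ^+ N))//.
    apply: ler_pM => //; first by rewrite mulr_ge0.
      by rewrite lerDl.
    by rewrite lerXn2r// nnegrE// invr_ge0.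
  by rewrite mulrC -ltr_pdivlMr.
move=> N; apply/ler_addgt0Pr => e e0.
have /cvgrPdist_lt/(_ e e0)[n _ /(_ (maxn n N))/=] := cu.
rewrite leq_maxl => /(_ isT) ln.
rewrite -(subrK (u (maxn n N)) (lim _)) -addrA (le_trans (ler_normD _ _))//.
rewrite [leRHS]addrC lerD//; first exact: ltW.
by rewrite uD// leq_maxr.
Qed.

(** Convergence of [u] to [l] at the rate of a geometric sequence of ratio
    one half. *)
Definition geom_cvg u l := exists M : C, forall N, `|l - u N| <= M * 2^-1 ^+ N.

Lemma geom_cvg_unique u l l' : geom_cvg u l -> geom_cvg u l' -> l = l'.
Proof.
move=> [M uM] [M' uM']; apply/eqP; rewrite -subr_eq0 -normr_eq0; apply/eqP.
apply: (@ler_half_expn_eq0 _ (M + M')) => // N.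
rewrite -(subrK (u N) l) -addrA (le_trans (ler_normD _ _))// mulrDl lerD//.
by rewrite distrC.
Qed.

Lemma geom_cvg_near u v l M : geom_cvg u l ->
  (forall N, `|u N - v N| <= M * 2^-1 ^+ N) -> geom_cvg v l.
Proof.
move=> [M' uM'] uv; exists (M' + M) => N.
rewrite -(subrK (u N) l) -addrA (le_trans (ler_normD _ _))// mulrDl.
exact: lerD.
Qed.

Lemma geom_cvgD (c : C) u v l m : geom_cvg u l -> geom_cvg v m ->
  geom_cvg (fun N => c *: u N + v N) (c *: l + m).
Proof.
move=> [M uM] [M' vM']; exists (`|c| * M + M') => N.
rewrite opprD addrACA -scalerBr (le_trans (ler_normD _ _))// mulrDl lerD//.
by rewrite normrZ -mulrA ler_wpM2l.
Qed.

End GeometricConvergence.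

Lemma geom_cvg_lie (R : realType) (L : banachLieType R[i]) (u v : nat -> L)
    (l m : L) :
  geom_cvg u l -> geom_cvg v m ->
  geom_cvg (fun N => lie (u N) (v N)) (lie l m).
Proof.
move=> [M uM] [M' vM']; have [t t0 tP] := @lie_bounded _ L.
have M0 : 0 <= M by have := uM 0%N; rewrite expr0 mulr1; exact: le_trans.
have uB N : `|u N| <= `|l| + M.
  rewrite -(subrK l (u N)) addrC (le_trans (ler_normD _ _))// lerD2l distrC.
  rewrite (le_trans (uM N))// ler_piMr// exprn_ile1// ?invr_ge0//.
  by rewrite invf_le1// ler1n.
exists (t * M * `|m| + t * (`|l| + M) * M') => N.
have -> : lie l m - lie (u N) (v N) = lie (l - u N) m + lie (u N) (m - v N).
  by rewrite lieBl lieBr addrA subrK.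
rewrite (le_trans (ler_normD _ _))// mulrDl lerD// (le_trans (tP _ _))//.
  have -> : t * M * `|m| * 2^-1 ^+ N = t * (M * 2^-1 ^+ N) * `|m| by ring.
  by rewrite ler_wpM2r// ler_wpM2l// ltW.
by rewrite -[leRHS]mulrA ler_pM ?mulr_ge0 ?ler_wpM2l// ltW.
Qed.

(** * Exponentials of bounded derivations *)

Section Antidiagonals.
Context {K : numFieldType} {V : normedModType K}.
Implicit Types F : nat -> nat -> V.

Lemma sum_antidiagonals F N :
  \sum_(0 <= k < N) \sum_(0 <= a < k.+1) F a (k - a)%N =
  \sum_(0 <= a < N) \sum_(0 <= b < N - a) F a b.
Proof.
elim: N => [|N IH]; first by rewrite !big_geq.
rewrite big_nat_recr//= {}IH [RHS]big_nat_recr//= subSnn big_nat1.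
rewrite [X in _ + X]big_nat_recr//= subnn addrA; congr (_ + _).
rewrite -big_split/=; apply: eq_big_nat => a /andP[_ aN].
by rewrite subSn ?(ltnW aN)// big_nat_recr.
Qed.

(** A truncated Cauchy product differs from the product of the truncations by
    at most [N ^ 2] terms, all of index at least [N]. *)
Lemma norm_cauchy_product F (M : K) N : 0 <= M ->
  (forall a b, `|F a b| <= M * 8^-1 ^+ (a + b)) ->
  `|\sum_(0 <= a < N) \sum_(0 <= b < N) F a b -
    \sum_(0 <= k < N) \sum_(0 <= a < k.+1) F a (k - a)%N| <= M * 2^-1 ^+ N.
Proof.
move=> M0 FM; rewrite sum_antidiagonals -sumrB.
have i8 : 0 <= (8^-1 : K) by rewrite invr_ge0.
have tailP a : (0 <= a < N)%N ->
    `|\sum_(0 <= b < N) F a b - \sum_(0 <= b < N - a) F a b| <=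
    N%:R * (M * 8^-1 ^+ N).
  move=> /andP[_ aN]; rewrite (big_cat_nat (leq0n (N - a)) (leq_subr _ _))/=.
  rewrite addrAC subrr add0r (le_trans (ler_norm_sum _ _ _))//.
  rewrite (@le_trans _ _ (\sum_(N - a <= b < N) M * 8^-1 ^+ N))//.
    apply: ler_sum_nat => b /andP[Nb _]; rewrite (le_trans (FM _ _))//.
    rewrite ler_wpM2l// ler_wiXn2l// ?invf_le1 ?ler1n//.
    by rewrite -leq_subLR.
  rewrite sumr_const_nat subKn ?(ltnW aN)// -[leLHS]mulr_natl.
  by rewrite ler_wpM2r ?mulr_ge0 ?exprn_ge0// ler_nat ltnW.
rewrite (le_trans (ler_norm_sum _ _ _))//.
rewrite (le_trans (ler_sum_nat tailP))// sumr_const_nat subn0 -[leLHS]mulr_natl.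
have -> : N%:R * (N%:R * (M * 8^-1 ^+ N)) =
    M * (N%:R * N%:R * 8^-1 ^+ N) :> K by ring.
rewrite ler_wpM2l//.
have -> : 8^-1 ^+ N = 4^-1 ^+ N * 2^-1 ^+ N :> K.
  by rewrite -exprMn -invfM -natrM.
rewrite mulrA ler_piMl ?exprn_ge0 ?invr_ge0//.
have -> : 4^-1 ^+ N = (2 ^ N * 2 ^ N)%:R^-1 :> K.
  by rewrite -expnMn natrX exprVn.
rewrite -natrM ler_pdivrMr ?ltr0n ?muln_gt0 ?expn_gt0// mul1r ler_nat.
by rewrite leq_mul// ltnW// ltn_expl.
Qed.

(** The factor [n + 1] is distributed as [a + (n + 1 - a)] over the terms. *)
Lemma scale_sum_antidiagonal F n :
  n.+1%:R *: \sum_(0 <= a < n.+2) F a (n.+1 - a)%N =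
  \sum_(0 <= a < n.+1)
    (a.+1%:R *: F a.+1 (n - a)%N + (n - a).+1%:R *: F a (n - a).+1).
Proof.
have -> : n.+1%:R *: \sum_(0 <= a < n.+2) F a (n.+1 - a)%N =
    \sum_(0 <= a < n.+2) (a%:R *: F a (n.+1 - a)%N) +
    \sum_(0 <= a < n.+2) ((n.+1 - a)%:R *: F a (n.+1 - a)%N).
  rewrite scaler_sumr -big_split/=; apply: eq_big_nat => a /andP[_ an].
  by rewrite -scalerDl -natrD subnKC.
rewrite big_split/=; congr (_ + _).
  by rewrite big_nat_recl//= scale0r add0r.
rewrite big_nat_recr//= subnn scale0r addr0.
by apply: eq_big_nat => a /andP[_ an]; rewrite subSn.
Qed.

End Antidiagonals.

Section Exponential.
Context {R : realType} {L : banachLieType R[i]}.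
Implicit Types (D : L -> L) (q : R[i]).

(** The axioms of a derivation, apart from boundedness. *)
Definition lie_derivation D :=
  (forall (c : R[i]) (x y : L), D (c *: x + y) = c *: D x + D y) /\
  (forall x y : L, D (lie x y) = lie (D x) y + lie x (D y)).

(** The term [D^n y / n!] of the exponential series. *)
Definition exp_term D n (y : L) : L := n`!%:R^-1 *: iter n D y.

Definition exp_sum D N y := \sum_(0 <= n < N) exp_term D n y.

(** The operator [exp D] at [y]; the limit exists for the small derivations
    below. *)
Definition lie_exp D y : L := lim (exp_sum D ^~ y @ \oo).

(** Derivations of norm at most [q <= 1/8]: the error terms of a Cauchy product
    truncated at [N], which are at most [N ^ 2], are then each bounded by a
    multiple of [8 ^- N], hence together by a multiple of [2 ^- N]. *)
Definition small_derivation D q :=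
  [/\ lie_derivation D, 0 <= q, q <= 8^-1 & forall x, `|D x| <= q * `|x|].

Lemma derivationN D : lie_derivation D -> lie_derivation (fun y => - D y).
Proof.
move=> [DD DL]; split=> [c x y|x y]; first by rewrite DD opprD scalerN.
have -> : lie (- D x) y = - lie (D x) y by rewrite -scaleN1r lieZl scaleN1r.
have -> : lie x (- D y) = - lie x (D y) by rewrite -scaleN1r lieZr scaleN1r.
by rewrite DL opprD.
Qed.

Lemma derivationZ (s : R[i]) D :
  lie_derivation D -> lie_derivation (fun y => s *: D y).
Proof.
move=> [DD DL]; split=> [c x y|x y].
  by rewrite DD scalerDr !scalerA [s * c]mulrC.
by rewrite DL scalerDr lieZl lieZr.
Qed.

Lemma small_derivationN D q :
  small_derivation D q -> small_derivation (fun y => - D y) q.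
Proof.
move=> [dD q0 q8 Dq]; split=> //; first exact: derivationN.
by move=> x; rewrite normrN.
Qed.

Section Linear.
Variables (D : L -> L) (dD : lie_derivation D).

Lemma derivation0 : D 0 = 0.
Proof.
by have := dD.1 (-1) 0 0; rewrite scaler0 addr0 scaleN1r addNr.
Qed.

Lemma derivationZr c x : D (c *: x) = c *: D x.
Proof. by have := dD.1 c x 0; rewrite !addr0 derivation0 addr0. Qed.

Lemma derivationD x y : D (x + y) = D x + D y.
Proof. by have := dD.1 1 x y; rewrite !scale1r. Qed.

Lemma derivation_sum N (f : nat -> L) :
  D (\sum_(0 <= n < N) f n) = \sum_(0 <= n < N) D (f n).
Proof. by apply: (big_morph D derivationD derivation0). Qed.

Lemma iter_derivation_linear n c x y :
  iter n D (c *: x + y) = c *: iter n D x + iter n D y.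
Proof. by elim: n => //= n ->; rewrite dD.1. Qed.

Lemma exp_term_linear n c x y :
  exp_term D n (c *: x + y) = c *: exp_term D n x + exp_term D n y.
Proof.
by rewrite /exp_term iter_derivation_linear scalerDr !scalerA mulrC.
Qed.

Lemma exp_term0 n : exp_term D n 0 = 0.
Proof.
have := exp_term_linear n (-1) 0 0.
by rewrite scaler0 addr0 scaleN1r addNr.
Qed.

Lemma exp_termZ n c x : exp_term D n (c *: x) = c *: exp_term D n x.
Proof. by have := exp_term_linear n c x 0; rewrite exp_term0 !addr0. Qed.

Lemma exp_termD n x y : exp_term D n (x + y) = exp_term D n x + exp_term D n y.
Proof. by have := exp_term_linear n 1 x y; rewrite !scale1r. Qed.

Lemma exp_sum_linear N c x y :
  exp_sum D N (c *: x + y) = c *: exp_sum D N x + exp_sum D N y.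
Proof.
rewrite /exp_sum scaler_sumr -big_split/=; apply: eq_bigr => n _.
exact: exp_term_linear.
Qed.

Lemma derivation_exp_term n y :
  D (exp_term D n y) = n.+1%:R *: exp_term D n.+1 y.
Proof.
rewrite /exp_term derivationZr iterS scalerA factS natrM invfM mulrA.
by rewrite mulfV ?mul1r// pnatr_eq0.
Qed.

Lemma derivation_exp_termC n y : D (exp_term D n y) = exp_term D n (D y).
Proof. by rewrite /exp_term derivationZr -iterS iterSr. Qed.

(** Leibniz formula, with divided powers of [D]. *)
Lemma exp_term_lie n y z : exp_term D n (lie y z) =
  \sum_(0 <= a < n.+1) lie (exp_term D a y) (exp_term D (n - a) z).
Proof.
elim: n => [|n IH].
  by rewrite big_nat1 subnn /exp_term/= !fact0 invr1 !scale1r.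
have n1 : n.+1%:R != 0 :> R[i] by rewrite pnatr_eq0.
apply: (scalerI n1); rewrite -derivation_exp_term IH derivation_sum.
rewrite (scale_sum_antidiagonal
  (fun a b => lie (exp_term D a y) (exp_term D b z))).
apply: eq_bigr => a _.
rewrite dD.2 !derivation_exp_term.
by congr (_ + _); [exact: lieZl|exact: lieZr].
Qed.

End Linear.

(** The Cauchy product of the series of [exp (- D)] and [exp D] is the series with
    terms [1, 0, 0] and so on. *)
Lemma exp_term_opp D k y : lie_derivation D ->
  \sum_(0 <= a < k.+1) exp_term (fun y => - D y) a (exp_term D (k - a) y) =
  if k is 0%N then y else 0.
Proof.
move=> dD; case: k => [|k].
  by rewrite big_nat1 subnn /exp_term/= !fact0 invr1 !scale1r.
have k1 : k.+1%:R != 0 :> R[i] by rewrite pnatr_eq0.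
apply: (scalerI k1); rewrite scaler0.
rewrite (scale_sum_antidiagonal
  (fun a b => exp_term (fun y => - D y) a (exp_term D b y))).
rewrite big1// => a _; have dN := derivationN dD.
rewrite -(derivation_exp_term dN) (derivation_exp_termC dN) -(exp_termZ dN).
rewrite -(derivation_exp_term dD) -(exp_termD dN) addNr.
exact: exp_term0.
Qed.

Section Bounds.
Variables (D : L -> L) (q : R[i]) (sD : small_derivation D q).

Let dD : lie_derivation D. Proof. by case: sD. Qed.
Let q_ge0 : 0 <= q. Proof. by case: sD. Qed.
Let q_le8 : q <= 8^-1. Proof. by case: sD. Qed.

Let q_le2 : q <= 2^-1.
Proof. by rewrite (le_trans q_le8)// lef_pV2 ?posrE// ler_nat. Qed.

Let qn_le2 n : q ^+ n <= 2^-1 ^+ n.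
Proof. by rewrite lerXn2r// nnegrE invr_ge0. Qed.

Lemma norm_exp_term n y : `|exp_term D n y| <= q ^+ n * `|y|.
Proof.
have Dn : `|iter n D y| <= q ^+ n * `|y|.
  elim: n => [|n IH]; first by rewrite expr0 mul1r.
  rewrite iterS exprS -mulrA; case: sD => _ _ _ Dq.
  by rewrite (le_trans (Dq _))// ler_wpM2l.
rewrite normrZ (le_trans _ Dn)// ler_piMl// normfV normr_nat.
by rewrite invf_le1 ?ler1n ?ltr0n fact_gt0.
Qed.

Lemma norm_lie_exp_sum N y :
  `|lie_exp D y - exp_sum D N y| <= 2 * `|y| * q ^+ N.
Proof.
apply: (geometric_cvg (u := exp_sum D ^~ y)) => // n.
by rewrite /exp_sum big_nat_recr//= addrAC subrr add0r mulrC norm_exp_term.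
Qed.

Lemma lie_exp_geom_cvg y : geom_cvg (exp_sum D ^~ y) (lie_exp D y).
Proof.
exists (2 * `|y|) => N; rewrite (le_trans (norm_lie_exp_sum _ _))//.
by rewrite ler_wpM2l// mulr_ge0.
Qed.

Lemma lie_exp_bounded : norm_bounded (lie_exp D).
Proof.
exists 2 => // y; have := norm_lie_exp_sum 0 y.
by rewrite /exp_sum big_geq// subr0 expr0 mulr1.
Qed.

Lemma lie_exp_lie_hom : lie_hom (lie_exp D).
Proof.
split=> [c x y|x y].
  apply: geom_cvg_unique (lie_exp_geom_cvg _) _.
  rewrite (_ : exp_sum D ^~ _ = fun N => c *: exp_sum D N x + exp_sum D N y).
    by apply: geom_cvgD; exact: lie_exp_geom_cvg.
  by apply/funext => N; exact: exp_sum_linear.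
apply: geom_cvg_unique (lie_exp_geom_cvg _) _.
have [t t0 tP] := @lie_bounded _ L.
apply: (geom_cvg_near (M := t * `|x| * `|y|)
  (geom_cvg_lie (lie_exp_geom_cvg x) (lie_exp_geom_cvg y))) => N.
have -> : lie (exp_sum D N x) (exp_sum D N y) =
    \sum_(0 <= a < N) \sum_(0 <= b < N) lie (exp_term D a x) (exp_term D b y).
  rewrite /exp_sum (big_morph (lie^~ _) (fun u v => lieDl u v _) (lie0l _)).
  apply: eq_bigr => a _.
  by rewrite (big_morph (lie _) (fun u v => lieDr u v _) (lie0r _)).
have -> : exp_sum D N (lie x y) = \sum_(0 <= k < N) \sum_(0 <= a < k.+1)
    lie (exp_term D a x) (exp_term D (k - a) y).
  by apply: eq_bigr => k _; exact: exp_term_lie.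
apply: norm_cauchy_product => [|a b]; first by rewrite !mulr_ge0// ltW.
rewrite (le_trans (tP _ _))// -!mulrA (ler_wpM2l (ltW t0))// exprD.
have -> : `|x| * (`|y| * (8^-1 ^+ a * 8^-1 ^+ b)) =
  (8^-1 ^+ a * `|x|) * (8^-1 ^+ b * `|y|) :> R[i] by ring.
rewrite ler_pM// (le_trans (norm_exp_term _ _))// ler_wpM2r// lerXn2r// nnegrE.
  by rewrite invr_ge0.
by rewrite invr_ge0.
Qed.

Lemma lie_exp_near1 y : `|lie_exp D y - y - D y| <= 2 * `|y| * q ^+ 2.
Proof.
have := norm_lie_exp_sum 2 y.
rewrite /exp_sum big_nat_recr//= big_nat1 /exp_term/= fact0 factS fact0 muln1.
by rewrite invr1 !scale1r opprD addrA.
Qed.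

End Bounds.

Lemma lie_expK D q : small_derivation D q ->
  cancel (lie_exp D) (lie_exp (fun y => - D y)).
Proof.
move=> sD y; set E := fun y => - D y.
have sE : small_derivation E q by exact: small_derivationN.
have [dD q0 q8 _] := sD; have [dE _ _ _] := sE.
have i8 : (0 : R[i]) <= 8^-1 by rewrite invr_ge0.
have q1 n : q ^+ n <= 8^-1 ^+ n by rewrite lerXn2r// nnegrE.
have q2 n : q ^+ n <= 2^-1 ^+ n.
  rewrite lerXn2r// ?nnegrE ?invr_ge0// (le_trans q8)//.
  by rewrite lef_pV2 ?posrE// ler_nat.
have SE N u : `|exp_sum E N u| <= 4 * `|u|.
  rewrite -(subrK (lie_exp E u) (exp_sum E N u)) (le_trans (ler_normD _ _))//.
  rewrite distrC (natrD _ 2 2) mulrDl lerD//.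
    rewrite (le_trans (norm_lie_exp_sum sE _ _))// ler_piMr ?mulr_ge0//.
    rewrite exprn_ile1// (le_trans q8)// invf_le1// ler1n//.
  have := norm_lie_exp_sum sE 0 u.
  by rewrite /exp_sum big_geq// subr0 expr0 mulr1.
(* The partial sums of [exp (- D)] at those of [exp D] converge to both sides. *)
have cE :
    geom_cvg (fun N => exp_sum E N (exp_sum D N y)) (lie_exp E (lie_exp D y)).
  apply: (geom_cvg_near (M := 4 * (2 * `|y|)) (lie_exp_geom_cvg sE _)) => N.
  have -> : exp_sum E N (lie_exp D y) - exp_sum E N (exp_sum D N y) =
      exp_sum E N (lie_exp D y - exp_sum D N y).
    have := exp_sum_linear dE N (-1) (exp_sum D N y) (lie_exp D y).
    by rewrite !scaleN1r ![- _ + _]addrC => ->.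
  rewrite (le_trans (SE _ _))// -mulrA ler_wpM2l//.
  rewrite (le_trans (norm_lie_exp_sum sD _ _))// ler_wpM2l ?mulr_ge0//.
apply: geom_cvg_unique cE _.
have cy : geom_cvg (fun N => if N is 0%N then 0 else y) y.
  exists `|y| => -[|N]; first by rewrite subr0 expr0 mulr1.
  by rewrite subrr normr0 mulr_ge0// exprn_ge0// invr_ge0.
apply: (geom_cvg_near (M := `|y|) cy) => N; rewrite distrC.
have -> : exp_sum E N (exp_sum D N y) =
    \sum_(0 <= a < N) \sum_(0 <= b < N) exp_term E a (exp_term D b y).
  apply: eq_bigr => a _.
  by rewrite (big_morph (exp_term E a) (exp_termD dE a) (exp_term0 dE a)).
have -> : (if N is 0%N then 0 else y) = \sum_(0 <= k < N) \sum_(0 <= a < k.+1)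
    exp_term E a (exp_term D (k - a) y).
  case: N => [|N]; first by rewrite big_geq.
  rewrite big_nat_recl//= exp_term_opp// big1 ?addr0// => k _.
  by rewrite exp_term_opp.
apply: norm_cauchy_product => // a b.
rewrite (le_trans (norm_exp_term sE _ _))// mulrC exprD.
rewrite [8^-1 ^+ a * _]mulrC mulrA.
rewrite ler_pM ?exprn_ge0// (le_trans (norm_exp_term sD _ _))// mulrC.
by rewrite ler_wpM2l.
Qed.

(** The derivative of [exp (s D)] at [s = 0] is [D], so a closed subspace stable
    under the exponentials of small derivations is stable under [D]. *)
Lemma derivation_invariant (V : set L) D :
  closed V -> lin_subspace V -> lie_derivation D -> norm_bounded D ->
  (forall E q, small_derivation E q -> forall y, V y -> V (lie_exp E y)) ->
  forall y, V y -> V (D y).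
Proof.
move=> cV sV dD [B B0 DB] expV y Vy; apply: cV; apply/closureP => e e0.
(* The scalar [s] makes [s D] small, and the error [2 |y| (s B) ^ 2 / s] of the
   difference quotient of [exp (s D)] at [y] less than [e]. *)
pose s := (8 * B + 1 + (2 * B ^+ 2 * `|y| + 1) / e)^-1.
have B2 : 0 <= 2 * B ^+ 2 * `|y|.
  by rewrite mulr_ge0// mulr_ge0// exprn_ge0// ltW.
have s1 : 0 < 8 * B + 1 by rewrite ltr_wpDl// mulr_ge0// ltW.
have s2 : 0 < (2 * B ^+ 2 * `|y| + 1) / e by rewrite divr_gt0// ltr_wpDl.
have s0 : 0 < s by rewrite invr_gt0 addr_gt0.
have sneq0 : s != 0 by rewrite gt_eqF.
have sB : s * B <= 8^-1.
  rewrite /s [leLHS]mulrC ler_pdivrMr; last by rewrite addr_gt0.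
  rewrite [leRHS]mulrC ler_pdivlMr// [leLHS]mulrC -addrA lerDl.
  by rewrite ltW// addr_gt0.
have sE : small_derivation (fun y => s *: D y) (s * B).
  split=> [|||x]; [exact: derivationZ| |exact: sB|].
    exact: mulr_ge0 (ltW s0) (ltW B0).
  by rewrite normrZ gtr0_norm// -mulrA ler_wpM2l ?(ltW s0).
set E := fun y => s *: D y in sE.
exists (s^-1 *: (lie_exp E y - y)).
  apply: lin_subspaceZ => //; apply: lin_subspaceB => //.
  exact: expV sE _ Vy.
have -> : D y - s^-1 *: (lie_exp E y - y) = - (s^-1 *: (lie_exp E y - y - E y)).
  by rewrite [in RHS]scalerBr /E scalerA mulVf// scale1r opprB.
rewrite normrN normrZ gtr0_norm; last by rewrite invr_gt0.
rewrite (@le_lt_trans _ _ (s^-1 * (2 * `|y| * (s * B) ^+ 2)))//.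
  have si : 0 <= s^-1 by apply: ltW; rewrite invr_gt0.
  exact: (ler_wpM2l si (lie_exp_near1 sE y)).
have -> : s^-1 * (2 * `|y| * (s * B) ^+ 2) = 2 * B ^+ 2 * `|y| * s by field.
rewrite /s ltr_pdivrMr; last by rewrite addr_gt0.
rewrite mulrDr [e * (_ / e)]mulrC divfK ?gt_eqF//.
by rewrite ltr_wpDl ?ltrDl// mulr_ge0// ltW.
Qed.

End Exponential.

(** * Invariance under derivations *)

Section Primitive.
Context {K : numFieldType} {L : banachLieType K}.
Implicit Types A I J : set L.

Lemma primitive_idealP J : primitive_ideal J <-> closed_ideal J /\
  forall A, lie_subideal A -> (forall a b, A a -> A b -> J (lie a b)) ->
  A `<=` J.
Proof.
split=> -[cJ pJ]; have [_ [_ sJ _]] := cJ; split=> // A sA AJ.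
  by apply: pJ => //; apply/(lie_commutator_sub _ _ sJ).
by apply: pJ => // a b Aa Ab; apply/((lie_commutator_sub A A sJ).1 AJ).
Qed.

Lemma setT_primitive : primitive_ideal [set: L].
Proof. by split=> //; split=> //; exact: closedT. Qed.

(** Primitivity passes to the inverse image under an automorphism. *)
Lemma preimage_primitive (f g : L -> L) J : lie_hom f -> lie_hom g ->
  norm_bounded f -> cancel f g -> cancel g f ->
  primitive_ideal J -> primitive_ideal (f @^-1` J).
Proof.
move=> fh gh fb fK gK /primitive_idealP[cJ pJ]; apply/primitive_idealP.
split=> [|A sA AJ]; first exact: preimage_closed_ideal.
have gAJ : g @^-1` A `<=` J.
  apply: pJ => [|a b Aa Ab]; first exact: preimage_subideal.
  by rewrite -(gK a) -(gK b) -fh.2; exact: AJ.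
by move=> a Aa; apply: gAJ; rewrite /preimage/= fK.
Qed.

End Primitive.

(** The closed linear span of the commutative closed Lie subideals. *)
Definition abelian_span (R : realType) (M : banachLieType R[i]) : set M :=
  closed_lspan (\bigcup_(I in [set I : set M |
    [/\ closed I, lie_subideal I & lie_commutative I]]) I).

Arguments abelian_span {R} M _.

Section Invariance.
Context {R : realType} {L : banachLieType R[i]}.
Implicit Types (D : L -> L) (I J : set L).

Lemma lie_expNK D q : small_derivation D q ->
  cancel (lie_exp (fun y => - D y)) (lie_exp D).
Proof.
move=> /small_derivationN/lie_expK; rewrite (_ : (fun y => - - D y) = D)//.
by apply/funext => y; rewrite opprK.
Qed.

Lemma P_V_min J : primitive_ideal J -> P_V L `<=` J.
Proof. by move=> pJ x; exact. Qed.

(** [P_V L] is itself primitive: it is the least primitive ideal of [L]. *)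
Lemma P_V_primitive : primitive_ideal (P_V L).
Proof.
apply/primitive_idealP; split.
  split; first by apply: closed_bigI => J [[]].
  split=> //.
    split=> [J [[_ [_ [J0 _] _]] _]//|c x y Px Py J pJ].
    by have [[_ [_ [_ JD] _]] _] := pJ; apply: JD; [exact: Px|exact: Py].
  move=> a b _ Pb J pJ; have [[_ [_ _ JL]] _] := pJ.
  by apply: JL => //; exact: Pb.
move=> A sA AP a Aa J pJ; have /primitive_idealP[_ JP] := pJ.
by apply: JP Aa => // x y Ax Ay; apply: AP pJ.
Qed.

Lemma P_V_derivation D : lie_derivation D -> norm_bounded D ->
  forall y, P_V L y -> P_V L (D y).
Proof.
have pP := P_V_primitive; have [[cP [_ sP _]] _] := pP.
move=> dD bD; apply: derivation_invariant => // E q sE y Py.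
suff /P_V_min/(_ y Py) : primitive_ideal (lie_exp E @^-1` P_V L) by [].
have sN := small_derivationN sE.
apply: (preimage_primitive (g := lie_exp (fun y => - E y))) => //.
- exact: lie_exp_lie_hom sE.
- exact: lie_exp_lie_hom sN.
- exact: lie_exp_bounded sE.
- exact: lie_expK sE.
- exact: lie_expNK sE.
Qed.

Lemma abelian_span_derivation D : lie_derivation D -> norm_bounded D ->
  forall y : L, abelian_span L y -> abelian_span L (D y).
Proof.
move=> dD bD; apply: derivation_invariant => //.
- exact: closed_lspan_closed.
- exact: closed_lspan_subspace.
move=> E q sE; have sN := small_derivationN sE.
have fh := lie_exp_lie_hom sE; have gh := lie_exp_lie_hom sN.
suff : abelian_span L `<=` lie_exp E @^-1` abelian_span L by [].
apply: closed_lspan_min.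
- apply: preimage_closed => //; first exact: lie_exp_bounded sE.
  exact: closed_lspan_closed.
- by apply: preimage_subspace => //; exact: closed_lspan_subspace.
move=> y [I [cI sI aI] Iy]; apply: sub_closed_lspan.
exists (lie_exp (fun y => - E y) @^-1` I); last first.
  by rewrite /preimage/= (lie_expK sE).
split.
- by apply: preimage_closed => //; exact: lie_exp_bounded sN.
- exact: preimage_subideal.
- move=> a b Ia Ib; rewrite -(lie_expNK sE (lie a b)) gh.2 aI//.
  exact: lie_hom0.
Qed.

Lemma lie_derivation_ad (x : L) : lie_derivation (lie x).
Proof.
split=> [c y z|y z]; first exact: lie_linearr.
have := lie_jacobi x y z; rewrite (lieC z (lie x y)) (lieC z x).
have -> : lie y (- lie x z) = - lie y (lie x z).
  by rewrite -scaleN1r lieZr scaleN1r.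
move=> /eqP; rewrite subr_eq0 subr_eq => /eqP ->.
by rewrite addrC.
Qed.

Lemma norm_bounded_ad (x : L) : norm_bounded (lie x).
Proof.
have [t t0 tP] := @lie_bounded _ L; exists (t * `|x| + 1) => [|y].
  by rewrite ltr_wpDl// mulr_ge0// ltW.
by rewrite (le_trans (tP _ _))// ler_wpM2r// lerDl.
Qed.

(** A sum of Lie subideals need not be an ideal; this one is, because its closure
    is stable under the automorphisms [exp (ad x)] with [x] small. *)
Lemma abelian_span_closed_ideal : closed_ideal (abelian_span L).
Proof.
split; first exact: closed_lspan_closed.
split=> //; first exact: closed_lspan_subspace.
move=> x y _; apply: abelian_span_derivation.
  exact: lie_derivation_ad.
exact: norm_bounded_ad.
Qed.

End Invariance.

Section Preradicals.
Context {R : realType}.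

(** Each closed subideal generated by its commutative ideals is generated by
    commutative subideals of the whole algebra. *)
Lemma map_s_S_AbelE : map_s (@S_Abel R) = @abelian_span R.
Proof.
apply: functional_extensionality_dep => L; apply/seteqP; split.
  apply: closed_lspan_min; [exact: closed_lspan_closed|
                            exact: closed_lspan_subspace|].
  move=> x [I [cI sI IE] Ix]; move: (Ix); rewrite -{1}IE => -[IP [y yS <-]].
  have vh := val_lie_hom IP.
  suff : S_Abel (subalg IP) `<=` (val : subalg IP -> L) @^-1` abelian_span L.
    exact.
  apply: closed_lspan_min.
  - apply: preimage_closed => //; first exact: val_bounded.
    exact: closed_lspan_closed.
  - by apply: preimage_subspace => //; exact: closed_lspan_subspace.
  move=> z [J [[cJ /ideal_subideal sJ] aJ] Jz]; apply: sub_closed_lspan.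
  exists ((val : subalg IP -> L) @` J); last by exists z.
  split; [exact: val_closed|exact: val_subideal|].
  by move=> _ _ [a Ja <-] [b Jb <-]; rewrite -lie_subE aJ.
apply: closed_lspan_min; [exact: closed_lspan_closed|
                          exact: closed_lspan_subspace|].
move=> x [I [cI sI aI] Ix]; apply: sub_closed_lspan; exists I => //.
split=> //; apply/seteqP; split=> [_ [IP [y _ <-]]|y Iy].
  exact: subalg_valP.
have IP : closed_subalgebra I by split=> //; exact: subideal_subalgebra.
exists IP; have [z zy] := subalg_lift IP Iy; exists z => //.
apply: sub_closed_lspan; exists setT => //; split.
  by split=> //; exact: closedT.
by move=> a b _ _; apply: val_inj; rewrite lie_subE raddf0; apply: aI;
  exact: subalg_valP.
Qed.

Variable L : banachLieType R[i].
Implicit Types I J : set L.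

(** [P_V J] is stable under the derivations that [L] induces on the ideal [J]. *)
Lemma val_P_V_ideal J (JP : closed_subalgebra J) : lie_ideal J ->
  closed_ideal ((val : subalg JP -> L) @` P_V (subalg JP)).
Proof.
move=> iJ; have [_ _ JL] := iJ.
have [[cP [_ sP _]] _] := @P_V_primitive _ (subalg JP).
split; first exact: val_closed.
split=> //; first exact: (image_subspace (val_lie_hom JP)).
move=> x _ _ [y Py <-].
have adP (z : subalg JP) : lie x (val z) \in subalg_pred JP.
  by apply/mem_set/JL => //; exact: subalg_valP.
pose D z := Subalg (adP z).
exists (D y) => //; apply: P_V_derivation Py.
  have [DD DL] := lie_derivation_ad x.
  by split=> *; apply: val_inj; [rewrite linearP; exact: DD|exact: DL].
have [B B0 xB] := norm_bounded_ad x.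
by exists B => // z; exact: xB.
Qed.

(** A primitive ideal [J] of [L] has the same least primitive ideal as [L]: the
    trace on [J] of a primitive ideal of [L] is primitive, and conversely
    [P_V J] is primitive in [L]. *)
Lemma map_sub_P_V J : primitive_ideal J -> map_sub (@P_V R) J = P_V L.
Proof.
move=> pJ; have [[cJ iJ] _] := pJ.
have JP : closed_subalgebra J by exact: closed_ideal_subalgebra.
have /primitive_idealP[cP PP] := @P_V_primitive R L.
apply/seteqP; split=> [_ [JP' [y Py <-]]|x Px].
  suff /P_V_min/(_ y Py) :
    primitive_ideal ((val : subalg JP' -> L) @^-1` P_V L) by [].
  apply/primitive_idealP; split.
    exact: (preimage_closed_ideal (val_lie_hom JP') (val_bounded JP')).
  move=> A sA AP a Aa.
  suff : (val : subalg JP' -> L) @` A `<=` P_V L by apply; exists a.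
  apply: PP; first by apply: val_subideal => //; exact: ideal_subideal.
  by move=> _ _ [b Ab <-] [c Ac <-]; rewrite -lie_subE; exact: AP.
exists JP; apply: P_V_min Px; apply/primitive_idealP.
split=> [|A sA AP]; first exact: val_P_V_ideal.
have /primitive_idealP[_ JPr] := pJ.
have AJ : A `<=` J.
  apply: JPr => // a b Aa Ab; have [y _ <-] := AP a b Aa Ab.
  exact: subalg_valP.
have /primitive_idealP[_ PJ] := @P_V_primitive R (subalg JP).
move=> a Aa; have [z za] := subalg_lift JP (AJ _ Aa).
exists z => //; apply: (PJ ((val : subalg JP -> L) @^-1` A)).
- exact: (preimage_subideal (val_lie_hom JP)).
- move=> u v Au Av; have [w Pw] := AP _ _ Au Av.
  by rewrite -lie_subE => /val_inj <-.
- by rewrite /preimage/= za.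
Qed.

Section Quotients.
Variables (I : set L) (IP : closed_ideal I).

Lemma quot_map_lie_hom : lie_hom (quot_map IP).
Proof.
split=> [c x y|x y]; last exact: quot_map_lie.
by rewrite quot_mapD quot_mapZ.
Qed.

Lemma quot_map_bounded : norm_bounded (quot_map IP).
Proof.
exists 1 => // x; rewrite mul1r norm_quotE -(RRe_real (normr_real x)) lecR.
apply: ge_inf; last by exists x.
exists 0 => _ [y _ <-]; rewrite -lecR RRe_real ?normr_real//.
exact: normr_ge0.
Qed.

Lemma quot_map_eq0 x : quot_map IP x = 0 <-> I x.
Proof.
by rewrite -(lie_hom0 quot_map_lie_hom) quot_map_eq subr0.
Qed.

(** The quotient map is open, so the image of a closed saturated subspace is
    closed. *)
Lemma quot_image_closed J : lin_subspace J -> I `<=` J -> closed J ->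
  closed (quot_map IP @` J).
Proof.
move=> sJ IJ cJ y /closureP cly; have [x xy] := quot_map_surj y.
exists x => //; apply: cJ; apply/closureP => e e0.
have [_ [z Jz <-]] := cly e e0.
rewrite -xy -(lie_homB _ _ quot_map_lie_hom) norm_quotE.
rewrite -(RRe_real (gtr0_real e0)) ltcR => /inf_lt.
case=> [|_ [w wE <-] we]; first by exists (complex.Re `|x - z|), (x - z).
exists (x - w); last first.
  by rewrite opprB addrC subrK -(RRe_real (normr_real w)) ltcR.
rewrite (_ : x - w = z + ((x - z) - w)); last first.
  by rewrite addrA [z + _]addrC subrK.
apply: lin_subspaceD => //; apply: IJ; apply/(quot_map_eq IP).
by rewrite wE.
Qed.

Lemma map_quotE P : map_quot P I = quot_map IP @^-1` P (lie_quot IP).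
Proof.
apply/seteqP; split=> [x [IP' PI]|x Px]; last by exists IP.
by rewrite (Prop_irrelevance IP IP').
Qed.

Lemma map_quot_closed_ideal : closed_ideal (map_quot (@abelian_span R) I).
Proof.
rewrite map_quotE.
apply: (preimage_closed_ideal quot_map_lie_hom quot_map_bounded).
exact: abelian_span_closed_ideal.
Qed.

Lemma sub_map_quot : I `<=` map_quot (@abelian_span R) I.
Proof.
move=> x Ix; rewrite map_quotE /preimage/= (quot_map_eq0 x).2//.
by have [] := closed_lspan_subspace (\bigcup_(J in [set J : set (lie_quot IP) |
  [/\ closed J, lie_subideal J & lie_commutative J]]) J).
Qed.

(** The successor step of the chain of [map_star] stays below every primitive
    ideal that contains the given term. *)
Lemma map_quot_primitive J : primitive_ideal J -> I `<=` J ->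
  map_quot (@abelian_span R) I `<=` J.
Proof.
move=> /primitive_idealP[[cJ [_ sJ _]] pJ] IJ; rewrite map_quotE.
have qh := quot_map_lie_hom.
have spanJ : abelian_span (lie_quot IP) `<=` quot_map IP @` J.
  apply: closed_lspan_min; [exact: quot_image_closed|exact: image_subspace|].
  move=> y [B [_ sB aB] By]; have [x xy] := quot_map_surj y.
  exists x => //; apply: (pJ (quot_map IP @^-1` B)).
  - exact: preimage_subideal.
  - by move=> a b Ba Bb; apply/IJ/quot_map_eq0; rewrite qh.2 aB.
  - by rewrite /preimage/= xy.
move=> x /spanJ[y Jy /quot_map_eq yx].
rewrite -(subKr y x); apply: lin_subspaceB => //; exact: IJ.
Qed.

(** If [A] is a subideal with [[A, A]] in [I], the closure of its image in
    [L / I] is a commutative closed subideal, hence contained in the span. *)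
Lemma map_quot_fixed : map_quot (@abelian_span R) I = I -> primitive_ideal I.
Proof.
move=> IE; apply/primitive_idealP; split=> // A sA AI a Aa.
have qh := quot_map_lie_hom.
rewrite -IE map_quotE; apply: sub_closed_lspan.
exists (closure (quot_map IP @` A)); last by apply: subset_closure; exists a.
split; first exact: closed_closure.
  by apply: closure_subideal; apply: image_subideal => //; exact: quot_map_surj.
apply: closure_commutative => _ _ [x Ax <-] [y Ay <-].
by rewrite -qh.2; apply/quot_map_eq0/AI.
Qed.

End Quotients.

End Preradicals.

(** * Transfinite sequences of sets *)

Section WellOrder.
Context {W : eqType} {le : rel W}.
Variable wo : well_order le.

(** The strict order of the well-order [le]. *)
Definition wo_lt (v w : W) := (v != w) && le v w.

Lemma wo_min (P : W -> Prop) : (exists w, P w) ->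
  exists w, P w /\ forall v, P v -> le w v.
Proof.
move=> [w Pw]; have [|m [[/asboolP Pm mP] _]] := wo (A := fun w => `[<P w>]).
  by exists w; exact/asboolP.
by exists m; split=> // v Pv; apply: mP; exact/asboolP.
Qed.

Lemma wo_refl w : le w w.
Proof. by have [_ [<-]] := wo_min (ex_intro (eq w) w erefl); exact. Qed.

Lemma wo_anti v w : le v w -> le w v -> v = w.
Proof.
have anti : antisymmetric le.
  move=> x y; apply: (@wo_chain_antisymmetric W le predT) => //.
  by move=> A _; exact: wo.
by move=> vw wv; apply: anti; rewrite vw.
Qed.

Lemma wo_lt_total v w : [\/ wo_lt v w, v = w | wo_lt w v].
Proof.
have [->|vw] := eqVneq v w; first by constructor 2.
have [m [[->|->] mP]] :=
    wo_min (ex_intro (fun u => u = v \/ u = w) v (or_introl erefl)).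
  by constructor 1; rewrite /wo_lt vw mP//; right.
by constructor 3; rewrite /wo_lt eq_sym vw mP//; left.
Qed.

Lemma wo_lt_le v w : wo_lt v w -> ~ le w v.
Proof. by move=> /andP[/eqP vw vlew] /(wo_anti vlew). Qed.

Lemma wo_ind (Phi : W -> Prop) :
  (forall w, (forall v, wo_lt v w -> Phi v) -> Phi w) -> forall w, Phi w.
Proof.
move=> ind w; apply: contrapT => Nw.
have [m [Nm mP]] := wo_min (ex_intro (fun w => ~ Phi w) w Nw).
by apply: Nm; apply: ind => v /wo_lt_le vm; apply: contrapT => /mP.
Qed.

(** Every element that is not the greatest has a successor. *)
Lemma wo_lt_succ u v : wo_lt u v -> exists2 s, covers (le := le) u s & le s v.
Proof.
move=> uv; have [s [us sP]] := wo_min (ex_intro (wo_lt u) v uv).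
exists s; last exact: sP.
split=> // x /wo_lt_le xs; have [/andP[]//|->|/sP//] := wo_lt_total x u.
exact: wo_refl.
Qed.

Context {X : Type}.
Variables (base : X) (next : X -> X) (lim : set X -> X).
Local Notation T := (transfinite base next lim wo).

Lemma transfinite_cases w :
  [\/ (forall v, ~ wo_lt v w) /\ T w = base,
      exists2 v, covers (le := le) v w & T w = next (T v) |
      (exists v, wo_lt v w) /\ T w = lim (T @` [set v | wo_lt v w])].
Proof.
have [[v vw]|wN] := pselect (exists v, covers (le := le) v w).
  by constructor 2; exists v => //; exact: transfinite_next.
have [wpos|w0] := pselect (exists v, wo_lt v w).
  by constructor 3; split=> //; exact: transfinite_lim.
have {}w0 v : ~ wo_lt v w by move=> vw; apply: w0; exists v.
constructor 1; split=> //; apply: transfinite_base => v.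
have [/w0//|->|/andP[]//] := wo_lt_total v w.
exact: wo_refl.
Qed.

Lemma transfinite_ind (Phi : X -> Prop) : Phi base ->
  (forall A, Phi A -> Phi (next A)) ->
  (forall F : set X, (forall A, F A -> Phi A) -> Phi (lim F)) ->
  forall w, Phi (T w).
Proof.
move=> Pb Pn Pl; apply: wo_ind => w IH.
have [[_ ->]//|[v [vw _] ->]|[_ ->]] := transfinite_cases w.
  by apply/Pn/IH.
by apply: Pl => _ [v vw <-]; exact: IH.
Qed.

End WellOrder.

(** Cantor's theorem, for injections. *)
Lemma no_injection_powerset (T : Type) (f : set T -> T) : ~ injective f.
Proof.
move=> finj; pose D := [set x | exists2 A, f A = x & ~ A x].
have [DfD|NDfD] := pselect (D (f D)).
  by have [A /finj -> /(_ DfD)] := DfD.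
by apply: (NDfD); exists D.
Qed.

(** An increasing transfinite chain of subsets of [T]; [good] is an invariant of
    its terms, along which the successor step is extensive. *)
Section IncreasingChain.
Context {T : Type}.
Variables (base : set T) (next : set T -> set T) (lim : set (set T) -> set T).
Variable good : set T -> Prop.
Hypothesis good_base : good base.
Hypothesis good_next : forall A, good A -> good (next A).
Hypothesis next_ge : forall A, good A -> A `<=` next A.
Hypothesis good_lim : forall F : set (set T), F !=set0 ->
  (forall A, F A -> good A) ->
  (forall A B, F A -> F B -> A `<=` B \/ B `<=` A) -> good (lim F).
Hypothesis lim_ge : forall (F : set (set T)) A, F A -> A `<=` lim F.

Lemma increasing_chain (W : eqType) (le : rel W) (wo : well_order le) w :
  good (transfinite base next lim wo w) /\
  forall v, wo_lt (le := le) v w ->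
    transfinite base next lim wo v `<=` transfinite base next lim wo w.
Proof.
set S := transfinite base next lim wo; move: w; apply: (wo_ind wo) => w IH.
have := transfinite_cases wo base next lim w; rewrite -/S.
move=> -[[w0 ->]|[v [vw wv] ->]|[[u uw] ->]].
- by split=> // v /w0.
- have [gv Sv] := IH _ vw; split=> [|u uw]; first exact: good_next.
  apply: subset_trans (next_ge gv); have [->//|u_v] := eqVneq u v.
  by apply: Sv; rewrite /wo_lt u_v; exact: wv.
- split=> [|v vw]; last by apply: lim_ge; exists v.
  apply: good_lim => [|_ [v vw <-]|_ _ [v vw <-] [v' v'w <-]].
  + by exists (S u), u.
  + by have [] := IH _ vw.
  + have [vv'|->|v'v] := wo_lt_total wo v v'; [left|by left|right].
      by have [_] := IH _ v'w; exact.
    by have [_] := IH _ vw; exact.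
Qed.

(** A chain of subsets of [T] indexed by a well-ordered type with more elements
    than there are subsets of [T] cannot be injective, hence stabilizes. *)
Lemma increasing_chain_fixed :
  exists (W : eqType) (le : rel W) (wo : well_order le) (w : W),
    next (transfinite base next lim wo w) = transfinite base next lim wo w.
Proof.
have [le wo] := well_ordering_principle (set (set T)).
exists (set (set T)), le, wo; apply: contrapT => Nfix.
apply: (@no_injection_powerset (set T) (transfinite base next lim wo)).
set S := transfinite base next lim wo in Nfix *.
have Slt u v : wo_lt (le := le) u v -> S u <> S v.
  move=> uv Suv; have [s us sv] := wo_lt_succ wo uv.
  apply: Nfix; exists u; apply/seteqP; split; last first.
    exact: next_ge (increasing_chain wo u).1.
  rewrite -(transfinite_next _ _ _ wo us) [X in _ `<=` X]Suv.
  have [->//|s_v] := eqVneq s v.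
  by apply: (increasing_chain wo v).2; rewrite /wo_lt s_v.
move=> u v Suv; have [/Slt//|//|/Slt] := wo_lt_total wo u v.
by rewrite Suv.
Qed.

End IncreasingChain.

(** * The two radicals *)

Section Radicals.
Context {R : realType}.
Variable L : banachLieType R[i].

Lemma map_circ_P_V : map_circ (@P_V R) L = P_V L.
Proof.
have nextT : map_sub (@P_V R) [set: L] = P_V L.
  exact/map_sub_P_V/setT_primitive.
have nextP : map_sub (@P_V R) (P_V L) = P_V L.
  exact/map_sub_P_V/P_V_primitive.
apply/seteqP; split=> [x [W [le [wo [w [AE Ax]]]]]|x Px].
  set A := transfinite _ _ _ _ _ in AE Ax.
  have [AT|AP] : A = setT \/ A = P_V L; last by rewrite -AP.
    apply: (transfinite_ind wo (Phi := fun A => A = setT \/ A = P_V L)).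
    - by left.
    - by move=> B [->|->]; right.
    - move=> F FP; have [FPV|FPV] := pselect (F (P_V L)); [right|left].
        apply/seteqP; split=> [y|y Py B /FP[|]->//].
        exact.
      apply/seteqP; split=> // y _ B FB.
      by have [->//|BP] := FP _ FB; move: FPV; rewrite -BP.
  by move: Ax; rewrite -AE AT nextT.
(* On two points the chain is [L], [P_V L], and its second term is fixed. *)
have [le wo] := well_ordering_principle bool.
have [b [_ bmin]] := wo_min wo (ex_intro (fun=> True) true I).
exists bool, le, wo, (~~ b).
have bb : covers (le := le) b (~~ b).
  split; first by rewrite bmin// andbT; case: (b).
  move=> u /andP[ub _]; rewrite (_ : u = b); first exact: wo_refl wo b.
  by case: u b ub {bmin} => -[].
have -> : transfinite setT (map_sub (@P_V R) (L := L))
    (fun F => \bigcap_(A in F) A) wo (~~ b) = P_V L.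
  rewrite (transfinite_next _ _ _ wo bb) transfinite_base// => v.
  exact: bmin.
by [].
Qed.

Lemma map_star_abelian_span : map_star (@abelian_span R) L = P_V L.
Proof.
pose good (A : set L) := closed_ideal A /\ A `<=` P_V L.
pose next := map_quot (@abelian_span R) (L := L).
pose lim (F : set (set L)) := closure (\bigcup_(A in F) A).
have PP := @P_V_primitive R L; have [[cP [_ [P0 _] _]] _] := PP.
have gb : good [set 0].
  split; last by move=> _ ->.
  split; first exact: closed_singleton.
  split=> //.
    by split=> // c x y -> ->; rewrite scaler0 addr0.
  by move=> a b _ ->; exact: lie0r.
have gn A : good A -> good (next A).
  move=> [iA AP]; split; first exact: map_quot_closed_ideal.
  exact: map_quot_primitive.
have nge A : good A -> A `<=` next A by move=> [iA _]; exact: sub_map_quot.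
have gl (F : set (set L)) : F !=set0 -> (forall A, F A -> good A) ->
    (forall A B, F A -> F B -> A `<=` B \/ B `<=` A) -> good (lim F).
  move=> [A0 FA0] Fg Fch; split; last first.
    by apply: closure_min => // x [A /Fg[_ AP]]; exact: AP.
  have sU : lin_subspace (\bigcup_(A in F) A).
    split; first by exists A0 => //; have [[_ [_ [A00 _] _]] _] := Fg _ FA0.
    move=> c x y [A FA Ax] [B FB By].
    have [[_ [_ [_ AD] _]] _] := Fg _ FA; have [[_ [_ [_ BD] _]] _] := Fg _ FB.
    have [AB|BA] := Fch _ _ FA FB.
      by exists B => //; apply: BD => //; exact: AB.
    by exists A => //; apply: AD => //; exact: BA.
  split; first exact: closed_closure.
  split=> //; first exact: closure_subspace.
  move=> a b _; apply: (lie_closure (A := setT)); last exact: subset_closure.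
  move=> u v _ [A FA Av]; exists A => //.
  by have [[_ [_ _ AL]] _] := Fg _ FA; exact: AL.
have lge (F : set (set L)) A : F A -> A `<=` lim F.
  by move=> FA x Ax; apply: subset_closure; exists A.
apply/seteqP; split=> [x [W [le [wo [w [_ Ax]]]]]|x Px].
  have [[_ AP] _] := increasing_chain gb gn nge gl lge wo w.
  exact: AP.
have [W [le [wo [w wfix]]]] := increasing_chain_fixed gb gn nge gl lge.
exists W, le, wo, w; split=> //.
have [[iA _] _] := increasing_chain gb gn nge gl lge wo w.
exact: P_V_min (map_quot_fixed iA wfix) _ Px.
Qed.

End Radicals.

Theorem theorem6p25 (R : realType) (L : banachLieType R[i]) :
  map_star (map_s S_Abel) L = map_circ P_V L.
Proof. by rewrite map_s_S_AbelE map_star_abelian_span map_circ_P_V. Qed.
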